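(* Fix a prime power $q$ and integers $k\ge1$, $t$ with $0\le t<k$, and $\lambda\ge1$. There exists a constant $n_0=n_0(q,k,t,\lambda)$ such that, for every $n\geq n_0$ (with $n\ge 2k$) and every $t$-$(n,k,\lambda)_q$ subspace design $D$, $$\operatorname{span}_{\mathbb{C}}\{g\boldsymbol{1}_D\mid g\in\operatorname{GL}(n,q)\}=U_0\oplus U_{t+1}\oplus U_{t+2}\oplus\cdots\oplus U_k,$$ where $\mathbb{C}^X=U_0\oplus U_1\oplus\cdots\oplus U_k$ is the orthogonal multiplicity-free decomposition of the permutation module on $X=\operatorname{Gr}_q(n,k)$ described in the context. In particular, $$\dim_{\mathbb{Q}}\operatorname{span}_{\mathbb{Q}}\{g\boldsymbol{1}_D\mid g\in\operatorname{GL}(n,q)\}={n\brack k}_q-{n\brack t}_q+1.$$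
   Context: $\operatorname{Gr}_q(n,k)$ is the set of $k$-dimensional subspaces of $\mathbb{F}_q^n$; $n\ge 2k$. A $t$-$(n,k,\lambda)_q$ subspace design is a non-empty subset $D\subseteq X=\operatorname{Gr}_q(n,k)$ such that every $t$-dimensional subspace of $\mathbb{F}_q^n$ is contained in exactly $\lambda$ elements of $D$. $\boldsymbol{1}_D\in\mathbb{C}^X$ is its characteristic vector. $\operatorname{GL}(n,q)$ acts naturally on $X$ and on $\mathbb{C}^X$ by $g\boldsymbol{1}_D=\boldsymbol{1}_{gD}$. ${n\brack k}_q=\frac{(q^n-1)\cdots(q^{n-k+1}-1)}{(q^k-1)\cdots(q-1)}$ is the Gaussian binomial coefficient, with ${n\brack 0}_q=1$ and ${n\brack k}_q=0$ for $k<0$ or $k>n$. Decomposition: $\mathbb{C}^X=U_0\oplus\cdots\oplus U_k$ is an orthogonal direct sum of pairwise non-isomorphic irreducible $\operatorname{GL}(n,q)$-modules with $\dim U_j={n\brack j}_q-{n\brack j-1}_q$. Concretely, let $P$ be the poset of all subspaces of $\mathbb{F}_q^n$ ordered by inclusion and ranked by dimension, $V(P)$ the complex vector space with orthonormal basis $P$, and $\mathsf{U}(x)=\sum_{y\ge x,\ \dim y=\dim x+1}y$ the up operator. A symmetric Jordan chain is a sequence $(v_1,\dots,v_h)$ of non-zero vectors, each homogeneous (supported on subspaces of one dimension, its rank), with $\mathsf{U}(v_{i-1})=v_i$, $\mathsf{U}(v_h)=0$, and $\operatorname{rk}(v_1)+\operatorname{rk}(v_h)=n$ (for $h=1$: $2\operatorname{rk}(v_1)=n$).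 $V(P)$ has an orthogonal basis that is a disjoint union of symmetric Jordan chains, and $U_j$ is the span of the rank-$k$ basis vectors lying in chains whose first vector has rank $j$. *)

(* Defs.v *)
From HB Require Import structures.
From mathcomp Require Import all_boot all_order all_algebra.
From mathcomp Require Import reals complex.

Set Implicit Arguments.
Unset Strict Implicit.
Unset Printing Implicit Defensive.

Import Order.TTheory GRing.Theory Num.Theory.
Local Open Scope ring_scope.

(* for the subtype structure of {vspace vT} over matrices *)
Import VectorInternalTheory.
HB.instance Definition _ (F : finFieldType) (vT : vectType F) :=
  [Countable of {vspace vT} by <:].
HB.instance Definition _ (F : finFieldType) (vT : vectType F) :=
  [Finite of {vspace vT} by <:].

Notation subspace F n := {vspace 'cV[F]_n}.

(* The projective lattice $P$, and $V(P)$ with $P$ as standard basis: the vector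
   f stands for the sum of the f x *: x, so C^X with X = Gr_q(n,k) is identified
   with the functions supported on subspaces of dimension k. *)
Notation VP C F n := {ffun subspace F n -> C^o}.

Section Design.
Variables (F : finFieldType) (n : nat).
Implicit Types (D : {set subspace F n}) (g : 'M[F]_n).

Definition subspace_design (t k lambda : nat) D : Prop :=
  [/\ D != set0,
      {in D, forall V, \dim V = k}
    & forall T : subspace F n, \dim T = t ->
        #|[set V in D | (T <= V)%VS]| = lambda].

Definition gl_act g (V : subspace F n) : subspace F n :=
  (linfun (mulmx g) @: V)%VS.

Definition charvec (K : fieldType) D : VP K F n := [ffun V => (V \in D)%:R].

(* g 1_D = 1_{gD} *)
Definition orbit_span (K : fieldType) D : {vspace VP K F n} :=
  <<[seq charvec K (gl_act g @: D) | g : 'M[F]_n in unitmx]>>%VS.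

End Design.

(* For n < k the factor with i = n vanishes, so the value is 0. *)
Definition gauss_binom (q n k : nat) : rat :=
  (\prod_(i < k) (q%:R ^+ (n - i) - 1)) / (\prod_(i < k) (q%:R ^+ (k - i) - 1)).

Section JordanBasis.
Variables (C : numClosedFieldType) (F : finFieldType) (n : nat).
Implicit Types (u v w : VP C F n) (c : seq (VP C F n)) (B : seq (seq (VP C F n))).

(* coefficient at y of the linear extension of
   x |-> \sum_(y >= x, \dim y = \dim x + 1) y *)
Definition up v : VP C F n :=
  [ffun y => \sum_(x | (x <= y)%VS && (\dim y == (\dim x).+1)) v x].

Definition dotp u v : C := \sum_x (u x : C) * (v x : C)^*.

Definition homogeneous (r : nat) v : bool :=
  [forall x, (v x != 0) ==> (\dim x == r)].

Definition symmetric_jordan_chain c : Prop :=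
  [/\ c != [::],
      {in c, forall v, v != 0 /\ exists r, homogeneous r v},
      sorted [rel v w | up v == w] c,
      up (last 0 c) = 0
    & exists r s, [/\ homogeneous r (head 0 c), homogeneous s (last 0 c)
                    & (r + s = n)%N]].

(* basis_of makes flatten B duplicate-free, so the chains are disjoint. *)
Definition orthogonal_symmetric_jordan_basis B : Prop :=
  [/\ {in B, forall c, symmetric_jordan_chain c},
      basis_of fullv (flatten B)
    & {in flatten B &, forall u v, u != v -> dotp u v = 0}].

Definition U_ (k : nat) B (j : nat) : {vspace VP C F n} :=
  let chains := [seq c <- B | homogeneous j (head 0%R c)] in
  <<[seq v <- flatten chains | homogeneous k v]>>%VS.

End JordanBasis.

(* Main.v *)
Require Import Defs.
From HB Require Import structures.
From mathcomp Require Import all_boot all_order all_algebra.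
From mathcomp Require Import reals complex.
From mathcomp Require Import zify ring.

(** Let X be the set of subspaces of dimension k, let D be the design, and let
    W_s send a function f on X to the function on the subspaces T of dimension s
    whose value at T is the sum of f over the members of X that contain T.  Each
    translate gD is a design with the same lambda, so W_t maps its characteristic
    vector to the constant lambda; hence the span S of the orbit lies in
    <1> + E0, where 1 is the constant function on X and E0 is the kernel of W_t
    on the functions on X.  The sum of all translates is a non-zero multiple of 1,
    so 1 lies in S, and the point is to show that E0 <= S when n is large.

    Let N(x, y) be the number of g in GL with x and y both in gD
    ([coinc_num]).  The operator N maps f to the sum over g of
    (sum of f over gD) times the characteristic vector of gD: its image lies in
    S, and it preserves E0.  It thus suffices that N is injective on E0, and we
    show that it is positive definite there ([coinc_num_definite]).  As GL is
    transitive on the pairs (x, y) with a given dimension of the intersection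
    ([gl_trans2]), N(x, y) is a function c_i of i = dim (x :&: y), and a
    unitriangular change of basis gives c_i = sum_s b_s [i choose s]_q.  But
    [dim (x :&: y) choose s]_q is the (x, y) entry of the Gram matrix of W_s, so
    that <N f, f> = sum_s b_s |W_s f|^2.  On E0 the terms with s <= t vanish, and
    W_k is the identity.  Counting incidences in D gives
    c_i = O(q^(-n(k - max(i, t)))) c_k ([coinc_num_bound]), hence
    b_k = (1 - O(q^-n)) c_k.  For t < s < k the coefficient b_s may be negative,
    but since c_s >= 0 it is at least -O(q^(-n(k - s + 1))) c_k, whereas
    |W_s f|^2 = O(q^(n(k - s))) |f|^2 ([inc_norm]).  Altogether
    <N f, f> >= (1 - O(q^-n)) c_k |f|^2, with constants that depend on q, k and
    lambda only.

    For the dimension of E0, W_t is onto the functions on the subspaces of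
    dimension t when 2k <= n ([inc_onto]): its transpose is a positive multiple
    of the power k - t of the up operator, and the up operator is injective on
    rank r for 2r < n because a subspace of dimension r has more upper covers
    than lower covers ([kup_inj]).

    In an orthogonal Jordan basis, a rank k vector whose chain starts in rank
    j <= t lies in the image of the power k - t of the up operator, hence is
    orthogonal to E0; one whose chain starts in rank j > t is orthogonal to that
    image, hence lies in E0.  Expanding an element of E0 in the basis, E0 is
    therefore the sum of the U_j with j > t, and for t = 0 the same dichotomy
    shows that U_0 is spanned by 1 ([U_sum]).

    The only analytic input is an endomorphism cj of the field with
    a * cj a = `|a|^2, so rational and complex coefficients are treated
    together, with cj the identity and complex conjugation. *)

Set Implicit Arguments.
Unset Strict Implicit.
Unset Printing Implicit Defensive.

Import Order.TTheory GRing.Theory Num.Theory.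

(** * Counting subspaces *)

Section Counting.
Variables (F : finFieldType) (n : nat).
Local Notation q := #|F|.
Implicit Types (U V x y z T : subspace F n) (v w : 'cV[F]_n).

Lemma q_gt1 : 1 < q.
Proof. exact: card_finNzRing_gt1. Qed.

Lemma card_vectors m p (U : {vspace 'M[F]_(m, p)}) :
  #|[set v | v \in U]| = q ^ \dim U.
Proof.
pose f (a : {ffun 'I_(\dim U) -> F}) : 'M[F]_(m, p) :=
  (\sum_i a i *: (vbasis U)`_i)%R.
have f_inj : injective f.
  move=> a b eq_ab; apply/ffunP => i; apply/eqP; rewrite -subr_eq0; apply/eqP.
  have /freeP/(_ (fun i => a i - b i)%R) := basis_free (vbasisP U).
  apply; under eq_bigr do rewrite scalerBl.
  by rewrite sumrB [X in (X - _)%R]eq_ab subrr.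
have -> : [set v | v \in U] = f @: [set: {ffun 'I_(\dim U) -> F}].
  apply/setP => v; rewrite inE; apply/idP/imsetP => [vU|[a _ ->]].
    exists [ffun i => coord (vbasis U) i v] => //.
    by rewrite {1}(coord_vbasis vU); apply: eq_bigr => i _; rewrite ffunE.
  by apply: memv_suml => i _; apply/memvZ/vbasis_mem/mem_nth; rewrite size_tuple.
by rewrite card_imset // cardsT card_ffun card_ord.
Qed.

Definition free_tuples m U : {set m.-tuple 'cV[F]_n} :=
  [set s : m.-tuple 'cV[F]_n | free s & (<<s>> <= U)%VS].

Lemma span_free_tuple m (s : m.-tuple 'cV[F]_n) :
  free s -> \dim <<s>> = m.
Proof. by move=> fs; rewrite (eqnP fs) size_tuple. Qed.

Lemma card_vectors_diff U V : (U <= V)%VS ->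
  #|[set v | (v \in V) && (v \notin U)]| = q ^ \dim V - q ^ \dim U.
Proof.
move=> UV; rewrite -!card_vectors.
have sUV : [set v | v \in U] \subset [set v | v \in V].
  by apply/subsetP => v; rewrite !inE; apply: (subvP UV).
rewrite -(setIidPr sUV) -cardsD; apply: eq_card => v.
by rewrite !inE andbC.
Qed.

(** The next vector of a free tuple is any vector outside the span of the others. *)
Lemma card_free_tuples m U :
  #|free_tuples m U| = \prod_(i < m) (q ^ \dim U - q ^ i).
Proof.
elim: m => [|m IHm].
  rewrite big_ord0; apply/eqP/cards1P; exists [tuple].
  by apply/setP => s; rewrite !inE (tuple0 s) eqxx nil_free span_nil sub0v.
rewrite big_ord_recr /= -IHm.
transitivity (\sum_(s in free_tuples m U)
   #|[set v | (v \in U) && (v \notin <<s>>%VS)]|); last first.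
  rewrite -sum_nat_const; apply: eq_bigr => s; rewrite inE => /andP[fs sU].
  by rewrite card_vectors_diff // span_free_tuple.
pose h (p : m.-tuple 'cV[F]_n * 'cV[F]_n) := [tuple of p.2 :: p.1].
have h_inj : injective h by move=> [s v] [s' v'] /(congr1 val) [-> /val_inj ->].
have -> : free_tuples m.+1 U = h @: [set p |
   (p.1 \in free_tuples m U) && ((p.2 \in U) && (p.2 \notin <<p.1>>%VS))].
  apply/setP => s; apply/idP/imsetP => [|[[s' v]]].
    case/tupleP: s => v s; rewrite !inE /= free_cons span_cons subv_add -memvE.
    case/andP=> /andP[vs fs] /andP[vU sU]; exists (s, v); last exact: val_inj.
    by rewrite !inE /= fs sU vU vs.
  rewrite !inE /= => /andP[/andP[fs sU] /andP[vU vs]] -> /=.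
  by rewrite free_cons fs vs span_cons subv_add -memvE vU sU.
rewrite card_imset //.
under [RHS]eq_bigr do rewrite -sum1_card.
rewrite pair_big_dep -sum1_card; apply: eq_bigl => -[s v].
by rewrite !inE.
Qed.

End Counting.

(** The Gaussian binomial coefficient, as the number of free s-tuples of a
    d-dimensional space over that of an s-dimensional space. *)
Definition gbin (q d s : nat) : nat :=
  (\prod_(i < s) (q ^ d - q ^ i)) %/ \prod_(i < s) (q ^ s - q ^ i).

Lemma gbin_den_gt0 q s : 1 < q -> 0 < \prod_(i < s) (q ^ s - q ^ i).
Proof. by move=> q1; apply: prodn_gt0 => i; rewrite subn_gt0 ltn_exp2l. Qed.

Lemma gbin_small q d s : d < s -> gbin q d s = 0.
Proof.
by move=> ds; rewrite /gbin (bigD1 (Ordinal ds)) //= subnn mul0n div0n.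
Qed.

Lemma gbinnn q d : 1 < q -> gbin q d d = 1.
Proof. by move=> q1; rewrite /gbin divnn gbin_den_gt0. Qed.

Section Subspaces.
Variables (F : finFieldType) (n : nat).
Local Notation q := #|F|.
Implicit Types (U V x y z T S : subspace F n) (v w : 'cV[F]_n).

Let q1 : 1 < q := q_gt1 F.

(** Sorting the free tuples of U by their spans. *)
Lemma card_subspaces_mul s U :
  #|[set T | (T <= U)%VS & \dim T == s]| * \prod_(i < s) (q ^ s - q ^ i)
    = \prod_(i < s) (q ^ \dim U - q ^ i).
Proof.
rewrite -card_free_tuples -[RHS]sum1_card.
rewrite (partition_big (fun w : s.-tuple 'cV[F]_n => <<w>>%VS)
  (mem [set T : subspace F n | (T <= U)%VS & \dim T == s])) /=; last first.
  by move=> w; rewrite !inE => /andP[fw wU]; rewrite wU span_free_tuple /=.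
rewrite -sum_nat_const; apply: eq_bigr => T; rewrite inE => /andP[TU /eqP dT].
rewrite -[X in q ^ X]dT -card_free_tuples -sum1_card; apply: eq_bigl => w.
rewrite !inE; apply/andP/andP => [[fw wT]|[/andP[fw wU] /eqP <-]] //.
split; first by rewrite fw (subv_trans wT TU).
by rewrite eqEdim wT dT span_free_tuple /=.
Qed.

Lemma card_subspaces s U :
  #|[set T | (T <= U)%VS & \dim T == s]| = gbin q (\dim U) s.
Proof.
by rewrite /gbin -(card_subspaces_mul s U) mulnK // gbin_den_gt0.
Qed.

Lemma dim_add_line S v : v \notin S -> \dim (S + <[v]>)%VS = (\dim S).+1.
Proof.
move=> vS; rewrite dimv_disjoint_sum.
  by rewrite dim_vline; case: eqP vS => [->|_ _]; rewrite ?mem0v ?addn1.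
apply/eqP; rewrite -subv0; apply/subvP => u /memv_capP[uS /vlineP[a ua]].
rewrite memv0; apply: contraNT vS => u0.
have a0 : a != 0%R by apply: contra_neq u0 => a0; rewrite ua a0 scale0r.
by rewrite -[v](scalerK a0) -ua memvZ.
Qed.

(** Each cover T of S inside y is S + <[v]> for exactly the vectors v of T
    outside S, and these sets of vectors partition y minus S. *)
Lemma card_covers_below S y : (S <= y)%VS ->
  #|[set T : subspace F n | (S <= T)%VS & (T <= y)%VS && (\dim T == (\dim S).+1)]|
    * (q ^ (\dim S).+1 - q ^ \dim S) = q ^ \dim y - q ^ \dim S.
Proof.
move=> Sy; rewrite -card_vectors_diff // -[RHS]sum1_card.
rewrite (partition_big (fun v : 'cV[F]_n => (S + <[v]>)%VS)
  (mem [set T : subspace F n | (S <= T)%VS & (T <= y)%VS && (\dim T == (\dim S).+1)]))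
  /=; last first.
  by move=> v; rewrite !inE => /andP[vy vS]; rewrite addvSl subv_add Sy -memvE vy dim_add_line /=.
rewrite -sum_nat_const; apply: eq_bigr => T; rewrite inE => /and3P[ST Ty /eqP dT].
rewrite -[in LHS]dT -card_vectors_diff // -sum1_card; apply: eq_bigl => v.
rewrite !inE; apply/andP/andP => [[vT vS]|[/andP[vy vS] /eqP <-]].
  rewrite vS (subvP Ty) //; split=> //.
  by rewrite eqEdim subv_add ST -memvE vT dT dim_add_line /=.
by rewrite vS memvE addvSr.
Qed.

End Subspaces.

(** * The action of the general linear group *)

Section GLAction.
Variables (F : finFieldType) (n : nat).
Implicit Types (U V x y z T S : subspace F n) (v w : 'cV[F]_n) (g h : 'M[F]_n).

Lemma mem_gl_act g V v : g \in unitmx ->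
  (v \in gl_act g V) = (invmx g *m v \in V)%R.
Proof.
move=> ug; apply/memv_imgP/idP => [[u uV ->]|vV].
  by rewrite lfunE /= mulKmx.
by exists (invmx g *m v)%R => //; rewrite lfunE /= mulKVmx.
Qed.

Lemma gl_actM g h V : gl_act (g *m h)%R V = gl_act g (gl_act h V).
Proof.
rewrite /gl_act -limg_comp; congr (_ @: _)%VS.
by apply/lfunP => v; rewrite comp_lfunE !lfunE /= mulmxA.
Qed.

Lemma gl_act1 V : gl_act (1%:M)%R V = V.
Proof. by apply/vspaceP => v; rewrite mem_gl_act ?unitmx1 // invmx1 mul1mx. Qed.

Lemma gl_actK g V : g \in unitmx -> gl_act (invmx g) (gl_act g V) = V.
Proof. by move=> ug; rewrite -gl_actM mulVmx // gl_act1. Qed.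

Lemma gl_actVK g V : g \in unitmx -> gl_act g (gl_act (invmx g) V) = V.
Proof. by move=> ug; rewrite -gl_actM mulmxV // gl_act1. Qed.

Lemma gl_act_inj g : g \in unitmx -> injective (@gl_act F n g).
Proof. by move=> ug V U eqVU; rewrite -(gl_actK V ug) eqVU gl_actK. Qed.

Lemma mem_gl_actS g (D : {set subspace F n}) V : g \in unitmx ->
  (V \in gl_act g @: D) = (gl_act (invmx g) V \in D).
Proof.
move=> ug; rewrite -{1}(gl_actVK V ug) mem_imset //; exact: gl_act_inj.
Qed.

Lemma lker_gl g : g \in unitmx -> lker (linfun (mulmx g) : 'End('cV[F]_n)) == 0%VS.
Proof.
move=> ug; apply/lker0P => v w; rewrite !lfunE /= => /(congr1 (mulmx (invmx g))).
by rewrite !mulKmx.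
Qed.

Lemma dim_gl_act g V : g \in unitmx -> \dim (gl_act g V) = \dim V.
Proof. by move=> ug; rewrite limg_dim_eq // (eqP (lker_gl ug)) capv0. Qed.

Lemma sub_gl_act g U V : g \in unitmx ->
  (gl_act g U <= gl_act g V)%VS = (U <= V)%VS.
Proof. by move=> ug; rewrite limg_ker0 // lker_gl. Qed.

Lemma lfun_mulmx (f : 'End('cV[F]_n)) :
  exists g : 'M[F]_n, forall v, f v = (g *m v)%R.
Proof.
exists (\matrix_(i, j) f (delta_mx j 0) i 0)%R => v.
rewrite {1}[v]matrix_sum_delta; under eq_bigr do rewrite big_ord1.
apply/matrixP => i j; rewrite linear_sum summxE mxE; apply: eq_bigr => l _.
by rewrite linearZ !mxE !ord1 mulrC.
Qed.

(** A basis adapted to both subspaces; its four segments have sizes that depend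
    only on the dimensions of x, of y and of their intersection. *)
Lemma flag_basis x y :
  basis_of fullv (vbasis (x :&: y)%VS ++ vbasis (x :\: y)%VS
                  ++ vbasis (y :\: x)%VS ++ vbasis ((x + y)^C)%VS).
Proof.
have -> : fullv = ((x :&: y) + ((x :\: y) + ((y :\: x) + (x + y)^C)))%VS.
  rewrite !addvA -{1}(addv_complf (x + y)%VS); congr (_ + _)%VS.
  rewrite [(x :&: y + _)%VS]addvC addv_diff_cap.
  by rewrite [RHS]addvC addv_diff addvC.
have d1 : ((y :\: x) :&: (x + y)^C = 0)%VS.
  apply/eqP; rewrite -subv0 -(capv_compl (x + y)) capvS //.
  by rewrite (subv_trans (diffvSl _ _)) // addvSr.
have d2 : ((x :\: y) :&: ((y :\: x) + (x + y)^C) = 0)%VS.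
  apply/eqP; rewrite -subv0; apply/subvP => u /memv_capP[ux].
  case/memv_addP => v vy [w wC uvw].
  have xu : u \in x by apply: (subvP (diffvSl x y)).
  have w0 : w = 0%R.
    apply/eqP; rewrite -memv0 -(capv_compl (x + y)) memv_cap wC andbT.
    have -> : (w = u - v)%R by rewrite uvw addrC addKr.
    apply: memvB; first exact: (subvP (addvSl x y)).
    by apply/(subvP (addvSr x y))/(subvP (diffvSl y x)).
  rewrite -(capv_diff x y) memv_cap ux uvw w0 addr0.
  by apply: (subvP (diffvSl y x)).
have d3 : ((x :&: y) :&: ((x :\: y) + ((y :\: x) + (x + y)^C)) = 0)%VS.
  apply/eqP; rewrite -subv0; apply/subvP => u /memv_capP[uxy].
  case/memv_addP => a ax [_ /memv_addP[b bx [c cC ->]] uabc].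
  have /memv_capP[ux uy] := uxy.
  have xa : a \in x by apply: (subvP (diffvSl x y)).
  have yb : b \in y by apply: (subvP (diffvSl y x)).
  have c0 : c = 0%R.
    apply/eqP; rewrite -memv0 -(capv_compl (x + y)) memv_cap cC andbT.
    have -> : (c = (u - a) - b)%R by rewrite uabc [(a + _)%R]addrC addrK [(b + _)%R]addrC addrK.
    apply: memvB; last exact: (subvP (addvSr x y)).
    by apply/(subvP (addvSl x y))/memvB.
  have ya : a \in y.
    have -> : (a = u - b)%R by rewrite uabc c0 addr0 addrK.
    exact: memvB.
  have a0 : a = 0%R.
    by apply/eqP; rewrite -memv0 -(capv_diff x y) memv_cap ax ya.
  rewrite -(capv_diff y x) memv_cap uabc a0 c0 addr0 add0r bx.
  have -> : (b = u)%R by rewrite uabc a0 c0 addr0 add0r.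
  by rewrite ux.
by do 3![apply: cat_basis; [exact/directv_addP | exact: vbasisP |]]; exact: vbasisP.
Qed.

(** The map between two adapted bases carries one pair to the other. *)
Lemma gl_trans2 x y x' y' :
  \dim x = \dim x' -> \dim y = \dim y' ->
  \dim (x :&: y) = \dim (x' :&: y') ->
  exists g, [/\ g \in unitmx, gl_act g x = x' & gl_act g y = y'].
Proof.
move=> dx dy dxy.
pose bas z t := (vbasis (z :&: t)%VS ++ vbasis (z :\: t)%VS
                 ++ vbasis (t :\: z)%VS ++ vbasis ((z + t)^C)%VS : seq 'cV[F]_n).
have bP z t : basis_of fullv (bas z t) by exact: flag_basis.
have dd : \dim (x :\: y) = \dim (x' :\: y').
  by have := dimv_cap_compl x y; have := dimv_cap_compl x' y'; lia.
have dd' : \dim (y :\: x) = \dim (y' :\: x').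
  have := dimv_cap_compl y x; have := dimv_cap_compl y' x'.
  by rewrite ![(y :&: _)%VS]capvC ![(y' :&: _)%VS]capvC; lia.
have ds : \dim (x + y) = \dim (x' + y').
  by have := dimv_sum_cap x y; have := dimv_sum_cap x' y'; lia.
have dc : \dim ((x + y)^C) = \dim ((x' + y')^C) by rewrite !dimv_compl ds.
have [f fE] := linear_of_free (bas x y) (bas x' y').
have [f' f'E] := linear_of_free (bas x' y') (bas x y).
have sz : size (bas x' y') = size (bas x y).
  by rewrite !size_cat !size_tuple dxy dd dd' dc.
move/(_ (basis_free (bP _ _)) sz) in fE.
move/(_ (basis_free (bP _ _)) (esym sz)) in f'E.
have [g gE] := lfun_mulmx (linfun f).
have [g' g'E] := lfun_mulmx (linfun f').
have gg' : (g' *m g = 1%:M)%R.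
  have fK : (linfun f' \o linfun f = \1)%VF.
    apply/(fullv_lfunP _ _ (span_basis (bP x y))) => v.
    rewrite comp_lfunE !lfunE /= => /(nthP 0%R)[i lti <-].
    by rewrite -(nth_map _ 0%R f) // fE -(nth_map _ 0%R f') ?sz // f'E.
  have vE v : (g' *m g *m v = v)%R by rewrite -mulmxA -gE -g'E -comp_lfunE fK id_lfunE.
  apply/matrixP => i j; move/matrixP/(_ i ord0): (vE (delta_mx j ord0)).
  rewrite -colE mxE => ->; rewrite !mxE eqxx andbT; congr (_%:R)%R.
have ug : g \in unitmx by have [] := mulmx1_unit gg'.
exists g; split=> //.
all: have linE : linfun (mulmx g) = linfun f :> 'End('cV[F]_n)
  by apply/lfunP => v; rewrite gE lfunE.
all: move: fE; rewrite !map_cat => /eqP; rewrite !eqseq_cat ?size_map ?size_tuple //.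
all: case/and4P => /eqP E1 /eqP E2 /eqP E3 /eqP E4.
all: have imE z z' : map f (vbasis z) = vbasis z' -> (linfun f @: z = z')%VS
  by (move=> E; rewrite -(span_basis (vbasisP z)) limg_span (eq_map (lfunE f)) E;
      apply/span_basis/vbasisP).
  rewrite /gl_act linE -(addv_diff_cap x y) limgD (imE _ _ E1) (imE _ _ E2).
  by rewrite addv_diff_cap.
rewrite /gl_act linE -(addv_diff_cap y x) limgD (imE _ _ E3).
by rewrite [(y :&: x)%VS]capvC (imE _ _ E1) capvC addv_diff_cap.
Qed.

Definition colspan m (w : 'M[F]_(n, m)) : subspace F n :=
  limg (linfun (mulmx w) : 'Hom('cV[F]_m, 'cV[F]_n)).

Lemma colspan_ex U : exists w : 'M[F]_(n, \dim U), colspan w = U.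
Proof.
exists (\matrix_(i, j) (vbasis U)`_j i 0)%R.
have mulE (a : 'cV[F]_(\dim U)) : ((\matrix_(i, j) (vbasis U)`_j i 0) *m a
   = \sum_(j < \dim U) a j 0 *: (vbasis U)`_j)%R.
  apply/matrixP => i l; rewrite ord1 summxE mxE; apply: eq_bigr => j _.
  by rewrite !mxE mulrC.
apply/vspaceP => v; apply/memv_imgP/idP => [[a _ ->]|vU].
  rewrite lfunE /= mulE memv_suml // => j _.
  by rewrite memvZ // vbasis_mem // mem_nth // size_tuple.
exists (\col_j coord (vbasis U) j v)%R; first exact: memvf.
rewrite lfunE /= mulE {1}(coord_vbasis vU); apply: eq_bigr => j _.
by rewrite mxE.
Qed.

(** Such a superspace is T + colspan w for some matrix w with m columns. *)
Lemma card_superspaces T m :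
  #|[set V | (T <= V)%VS & \dim V == \dim T + m]| <= #|F| ^ (n * m).
Proof.
rewrite -card_mx -cardsT.
apply: leq_trans (leq_imset_card (fun w : 'M[F]_(n, m) => (T + colspan w)%VS) _).
apply/subset_leq_card/subsetP => V; rewrite inE => /andP[TV /eqP dV].
have dVT : \dim (V :\: T) = m.
  by have := dimv_cap_compl V T; rewrite (capv_idPr TV) dV; lia.
have [w wE] := colspan_ex (V :\: T).
apply/imsetP; rewrite dVT in w wE *; exists w => //.
by rewrite wE addvC addv_diff addvC; apply/esym/addv_idPr.
Qed.

End GLAction.

(** * Covering relations in the lattice of subspaces *)

Section Covers.
Variables (F : finFieldType) (n : nat).
Local Notation q := #|F|.
Local Notation P := (subspace F n).
Implicit Types (x y z T S : P).

Let q1 : 1 < q := q_gt1 F.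

Definition cov x y : nat := (x <= y)%VS && (\dim y == (\dim x).+1).
Definition below s T y : nat := (T <= y)%VS && (\dim T == s).

Lemma dim_full : \dim (fullv : P) = n.
Proof. by rewrite dimvf /dim /= muln1. Qed.

(** The number of covers z of x with z <= y depends on dimensions only. This one
    count relates the incidence maps of consecutive dimensions to the up
    operator and to its transpose. *)
Lemma sum_cov_below x y r : \dim x = r ->
  (\sum_z cov x z * below r.+1 z y) * (q ^ r.+1 - q ^ r)
    = below r x y * (q ^ \dim y - q ^ r).
Proof.
move=> dx; rewrite /below dx eqxx andbT.
have [xy|xy] := boolP (x <= y)%VS; last first.
  rewrite mul0n big1 ?mul0n // => z _; rewrite /cov.
  case: (boolP (x <= z)%VS) => //= xz; case: (boolP (z <= y)%VS) => /=; last by rewrite muln0.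
  by move/(subv_trans xz); rewrite (negPf xy).
rewrite mul1n -[in RHS]dx -card_covers_below // dx; congr (_ * _).
rewrite -sum1_card [RHS]big_mkcond; apply: eq_bigr => z _.
rewrite inE /cov dx; case: (x <= z)%VS => //=.
by case: (z <= y)%VS; case: (\dim z == r.+1).
Qed.

Lemma card_upper_covers x :
  (\sum_y cov x y) * (q ^ (\dim x).+1 - q ^ \dim x) = q ^ n - q ^ \dim x.
Proof.
have := @sum_cov_below x fullv _ erefl.
rewrite {2}/below eqxx andbT subvf mul1n dim_full => <-; congr (_ * _).
apply: eq_bigr => z _; rewrite /cov /below subvf.
by case: (_ == _); rewrite !(andbT, andbF, muln1, muln0).
Qed.

Lemma gbin_mul d s :
  gbin q d s * \prod_(i < s) (q ^ s - q ^ i) = \prod_(i < s) (q ^ d - q ^ i).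
Proof.
have := card_subspaces_mul s (fullv : subspace F d).
by rewrite card_subspaces dimvf /dim /= muln1.
Qed.

(** Up to powers of q, the two products in [gbin] share all but one factor. *)
Lemma gbin_hyperplanes m : gbin q m.+1 m * (q - 1) = q ^ m.+1 - 1.
Proof.
have den0 := gbin_den_gt0 m q1.
have num : \prod_(i < m) (q ^ m.+1 - q ^ i) * (q - 1)
    = (q ^ m.+1 - 1) * \prod_(i < m) (q ^ m - q ^ i).
  case: m den0 => [|m] den0; first by rewrite !big_ord0 muln1 mul1n expn1.
  rewrite big_ord_recl [in RHS]big_ord_recr /= expn0 -!mulnA; congr (_ * _).
  under eq_bigr => i _ do rewrite /bump /= add1n [q ^ m.+2]expnS [q ^ i.+1]expnS -mulnBr.
  have -> : q ^ m.+1 - q ^ m = (q - 1) * q ^ m by rewrite mulnBl mul1n expnS.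
  by rewrite big_split prod_nat_const card_ord /=; ring.
by apply/eqP; rewrite -(eqn_pmul2r den0) mulnAC gbin_mul num.
Qed.

Lemma card_lower_covers x : (\sum_y cov y x) * (q - 1) = q ^ \dim x - 1.
Proof.
have [d0|[m dx]] : \dim x = 0 \/ exists m, \dim x = m.+1.
- by case: (\dim x) => [|m]; [left|right; exists m].
- by rewrite d0 big1 // => y _; rewrite /cov d0 andbF.
rewrite dx -gbin_hyperplanes -dx -card_subspaces; congr (_ * _).
rewrite -sum1_card [RHS]big_mkcond; apply: eq_bigr => y _.
by rewrite inE /cov dx eqSS [m == _]eq_sym; case: (_ && _).
Qed.

(** This difference is what makes the up operator injective below the middle
    rank. *)
Lemma card_covers_diff x r : \dim x = r -> r <= n - r ->
  (\sum_y cov x y) * (q - 1) = (\sum_y cov y x) * (q - 1) + (q ^ (n - r) - q ^ r).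
Proof.
move=> dx rn; have := card_upper_covers x; rewrite card_lower_covers dx => up.
have qr : 0 < q ^ r by rewrite expn_gt0 ltnW.
have qrn : q ^ r <= q ^ (n - r) by rewrite leq_exp2l.
have -> : q ^ r - 1 + (q ^ (n - r) - q ^ r) = q ^ (n - r) - 1 by lia.
apply/eqP; rewrite -(eqn_pmul2r qr).
rewrite -mulnA [(q - 1) * _]mulnBl mul1n -expnS up.
by rewrite mulnBl mul1n -expnD subnK //; lia.
Qed.

(** Two distinct subspaces have a common upper cover, necessarily their sum, if
    and only if they have a common lower cover, their intersection. *)
Lemma cov_cov_off x z : x != z ->
  \sum_y cov x y * cov z y = \sum_y cov y x * cov y z.
Proof.
move=> xz.
pose b := (\dim x == \dim z) && (\dim (x + z) == (\dim x).+1)%VS.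
have zx : \dim x = \dim z -> ~~ (z <= x)%VS.
  by move=> d; apply: contra xz => zx; rewrite eq_sym eqEdim zx d /=.
have -> : \sum_y cov x y * cov z y = b.
  rewrite (bigD1 (x + z)%VS) //= big1 => [|y yxz].
    rewrite addn0 /cov addvSl addvSr /b /= mulnb [_ == \dim z]eq_sym.
    case: eqP => [->|]; last by rewrite andbF.
    by rewrite eqSS /= andbT eq_sym.
  apply/eqP; rewrite mulnb eqb0; apply: contra yxz.
  case/andP => /andP[xy /eqP dy] /andP[zy /eqP dy'].
  have dxz : \dim x = \dim z by lia.
  rewrite eq_sym eqEdim subv_add xy zy dy /= ltnNge; apply: contra (zx dxz) => le.
  suff /eqP -> : x == (x + z)%VS by exact: addvSr.
  by rewrite eqEdim addvSl le.
have -> // : \sum_y cov y x * cov y z = b.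
have dc := dimv_sum_cap x z.
rewrite (bigD1 (x :&: z)%VS) //= big1 => [|y yxz].
  rewrite addn0 /cov capvSl capvSr /b /= mulnb.
  by case: eqP; case: eqP; case: eqP; case: eqP; lia.
apply/eqP; rewrite mulnb eqb0; apply: contra yxz.
case/andP => /andP[xy /eqP dy] /andP[zy /eqP dy'].
have dxz : \dim x = \dim z by lia.
rewrite eqEdim subv_cap xy zy /= -ltnS -dy ltnNge; apply: contra (zx dxz) => le.
suff /eqP <- : (x :&: z)%VS == z by exact: capvSl.
by rewrite eqEdim capvSr -dxz le.
Qed.

End Covers.

Arguments cov {F n}.
Arguments below {F n}.

(** * Coincidence numbers of a design *)

Section DesignCounting.
Variables (F : finFieldType) (n : nat).
Local Notation q := #|F|.
Local Notation P := (subspace F n).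
Implicit Types (x y z T S V : P) (D : {set P}) (g h : 'M[F]_n).

Let q1 : 1 < q := q_gt1 F.

Lemma subspace_between S y m : (S <= y)%VS -> \dim S <= m <= \dim y ->
  exists T, [/\ (S <= T)%VS, (T <= y)%VS & \dim T = m].
Proof.
move=> Sy /andP[]; elim: m => [|m IHm] Sm my.
  by exists S; split=> //; apply/eqP; rewrite -leqn0.
move: Sm; rewrite leq_eqVlt => /predU1P[Sm|Sm]; first by exists S.
have [T [ST Ty dT]] := IHm Sm (ltnW my).
have /subvPn[v vy vT] : ~~ (y <= T)%VS.
  by apply: contraL my => /dimvS; rewrite dT -leqNgt.
exists (T + <[v]>)%VS; rewrite dim_add_line // dT subv_add Ty -memvE vy.
by rewrite (subv_trans ST) ?addvSl.
Qed.

(** A block above T contains a t-dimensional subspace above T, and these are few;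
    for dim T >= t the truncated subtraction gives the bound lambda. *)
Lemma design_above D t k lambda T : subspace_design t k lambda D -> t <= k ->
  #|[set V in D | (T <= V)%VS]| <= lambda * q ^ (n * (t - \dim T)).
Proof.
case=> _ dimD lamD tk; have [tT|Tt] := leqP t (\dim T).
  (* the blocks above T are among those above a fixed T' <= T of dimension t *)
  have [|T' [_ T'T dT']] := @subspace_between 0%VS T t (sub0v _).
    by rewrite dimv0 tT.
  rewrite -(lamD T') // -[leqLHS]muln1 leq_mul ?expn_gt0 ?(ltnW q1) //.
  apply/subset_leq_card/subsetP => V; rewrite !inE => /andP[-> TV] /=.
  exact: subv_trans T'T TV.
pose up := [set T' : P | (T <= T')%VS & \dim T' == \dim T + (t - \dim T)].
apply: (@leq_trans (lambda * #|up|)); last by rewrite leq_mul // card_superspaces.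
rewrite mulnC -sum_nat_const.
have -> : \sum_(T' in up) lambda = \sum_(T' in up) #|[set V in D | (T' <= V)%VS]|.
  apply: eq_bigr => T'; rewrite inE => /andP[_ /eqP dT'].
  by rewrite lamD // dT' subnKC // ltnW.
apply: (@leq_trans #|\bigcup_(T' in up) [set V in D | (T' <= V)%VS]|).
  apply/subset_leq_card/subsetP => V; rewrite inE => /andP[VD TV].
  have [|T' [TT' T'V dT']] := @subspace_between T V t TV.
    by rewrite ltnW //= dimD.
  by apply/bigcupP; exists T'; rewrite inE ?VD ?T'V // TT' dT' subnKC /= ?eqxx // (ltnW Tt).
elim/big_ind2: _ => [|m A p B mA pB|//]; first by rewrite cards0.
by rewrite (leq_trans (leq_card_setU _ _)) // leq_add.
Qed.

Lemma card_colspan_sub V m :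
  #|[set w : 'M[F]_(n, m) | (colspan w <= V)%VS]| <= q ^ (\dim V * m).
Proof.
pose f (w : 'M[F]_(n, m)) := [ffun j => col j w].
have f_inj : injective f.
  move=> w w' /ffunP eq; apply/matrixP => i j; have := eq j; rewrite !ffunE.
  by move/colP/(_ i); rewrite !mxE.
rewrite -(card_imset _ f_inj) expnM -card_vectors -[m in leqRHS]card_ord.
rewrite -card_ffun_on; apply/subset_leq_card/subsetP => u /imsetP[w].
rewrite inE => /subvP wV ->; apply/ffun_onP => j; rewrite ffunE inE; apply: wV.
by apply/memv_imgP; exists (delta_mx j 0)%R; rewrite ?memvf // lfunE /= colE.
Qed.

(** The matrices of full column rank whose column span meets x trivially. *)
Definition frames x m : {set 'M[F]_(n, m)} :=
  [set w : 'M[F]_(n, m) | [forall a : 'cV[F]_m, (a != 0%R) ==> ((w *m a)%R \notin x)]].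

Lemma frames_span x m w T : w \in frames x m -> (T <= x)%VS ->
  \dim (T + colspan w) = \dim T + m /\ (x :&: (T + colspan w) = T)%VS.
Proof.
rewrite inE => /forallP wx Tx.
have xw : (x :&: colspan w = 0)%VS.
  apply/eqP; rewrite -subv0; apply/subvP => v /memv_capP[vx /memv_imgP[a _ va]].
  rewrite {}va {v} lfunE /= in vx *; have := wx a; rewrite vx implybF negbK => /eqP->.
  by rewrite mulmx0 mem0v.
have dw : \dim (colspan w) = m.
  rewrite /colspan limg_dim_eq ?capfv ?dimvf ?/dim /= ?muln1 //.
  apply/eqP; rewrite -subv0; apply/subvP => a; rewrite memv_ker lfunE /= memv0.
  by move=> /eqP wa; have := wx a; rewrite wa mem0v implybF negbK.
split.
  rewrite dimv_disjoint_sum ?dw //; apply/eqP; rewrite -subv0 -xw.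
  by rewrite capvS.
rewrite capvC -vspace_modl // [(colspan w :&: _)%VS]capvC xw addv0 //.
Qed.

Lemma card_mulmx_in x m (a : 'cV[F]_m) : a != 0%R ->
  #|[set w : 'M[F]_(n, m) | (w *m a)%R \in x]| * q ^ n <= q ^ \dim x * q ^ (n * m).
Proof.
move=> a0; pose f := linfun (mulmxr a) : 'Hom('M[F]_(n, m), 'cV[F]_n).
have -> : [set w | (w *m a)%R \in x] = [set w | w \in (f @^-1: x)%VS].
  by apply/setP => w; rewrite !inE -memv_preim lfunE.
rewrite card_vectors -!expnD leq_exp2l // -(limg_ker_dim f (f @^-1: x)).
have := limg_ker_dim f fullv; rewrite capfv [\dim {:_}]dimvf [X in _ = X]/dim /=.
have -> : (f @: fullv = fullv)%VS.
  apply/vspaceP => v; rewrite memvf; apply/memv_imgP.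
  have [j aj] : exists j, a j ord0 != 0%R.
    apply/existsP; apply: contraNT a0 => /existsPn az; apply/eqP/colP => j.
    by rewrite mxE; apply/eqP; have := az j; rewrite negbK.
  exists ((a j ord0)^-1 *: (v *m delta_mx ord0 j))%R; first exact: memvf.
  rewrite lfunE /= -scalemxAl -mulmxA -rowE; apply/colP => i.
  by rewrite !mxE big_ord1 !mxE mulrCA mulVf // mulr1.
have le1 : \dim (f @: (f @^-1: x)) <= \dim x.
  by apply/dimvS/subvP => v /memv_imgP[w wx ->]; rewrite memv_preim.
have le2 := dimvS (capvSr (f @^-1: x)%VS (lker f)).
by rewrite dim_full => dk; lia.
Qed.

(** For each non-zero a the condition that w *m a lies in x has probability
    q ^ (dim x - n), and there are fewer than q ^ m such vectors a. *)
Lemma card_frames x m : \dim x + m < n -> q ^ (n * m) <= 2 * #|frames x m|.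
Proof.
move=> xmn.
pose bad (a : 'cV[F]_m) := [set w : 'M[F]_(n, m) | (w *m a)%R \in x].
have badE : ~: frames x m = \bigcup_(a : 'cV[F]_m | a != 0%R) bad a.
  apply/setP => w; rewrite !inE negb_forall; apply/existsP/bigcupP => [[a]|[a a0]].
    by rewrite negb_imply negbK => /andP[a0 wa]; exists a; rewrite ?inE.
  by rewrite inE => wa; exists a; rewrite a0 wa.
have le1 : #|~: frames x m| * q ^ n <= q ^ m * (q ^ \dim x * q ^ (n * m)).
  have -> : q ^ m = #|{: 'cV[F]_m}| by rewrite card_mx muln1.
  apply: (@leq_trans (\sum_(a : 'cV[F]_m | a != 0%R) #|bad a| * q ^ n)).
    rewrite -big_distrl leq_mul //= badE.
    elim/big_ind2: _ => [|p A p' B pA p'B|//]; first by rewrite cards0.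
    by rewrite (leq_trans (leq_card_setU _ _)) // leq_add.
  rewrite -sum_nat_const big_mkcond /= leq_sum // => a _.
  by case: ifP => // a0; exact: card_mulmx_in.
have q0 j : 0 < q ^ j by rewrite expn_gt0 ltnW.
have le2 : 2 * #|~: frames x m| <= q ^ (n * m).
  rewrite -(leq_pmul2r (q0 n)) -mulnA (leq_trans (leq_mul (leqnn 2) le1)) //.
  rewrite !mulnA [leqRHS]mulnC leq_mul // -mulnA -expnD.
  by rewrite (leq_trans (leq_mul q1 (leqnn _))) // -expnS leq_exp2l // addnC.
move: le2 (cardsC (frames x m)); rewrite card_mx.
move: #|~: _| #|frames _ _| (q ^ _) => a b c; lia.
Qed.

(** Up to the factor #|GL|, the probability that a random translate of D contains
    both x and y. *)
Definition coinc_num D x y : nat :=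
  #|[set g in unitmx | (x \in gl_act g @: D) && (y \in gl_act g @: D)]|.

Lemma coinc_num_gl D h x y : h \in unitmx ->
  coinc_num D (gl_act h x) (gl_act h y) = coinc_num D x y.
Proof.
move=> uh; have mul_inj : injective (mulmx h : 'M[F]_n -> 'M[F]_n).
  by move=> g g' /(congr1 (mulmx (invmx h))); rewrite !mulKmx.
rewrite -[RHS](card_imset _ mul_inj); apply: eq_card => g.
have E z g' : (gl_act h z \in gl_act (h *m g')%R @: D) = (z \in gl_act g' @: D).
  rewrite (eq_imset _ (gl_actM h g')) (imset_comp (gl_act h)) mem_imset //.
  exact: gl_act_inj.
apply/idP/imsetP => [|[g' + ->]].
  rewrite inE => /andP[ug gD]; exists (invmx h *m g)%R; last by rewrite mulKVmx.
  have ug' : (invmx h *m g)%R \in unitmx by rewrite unitmx_mul unitmx_inv uh.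
  by rewrite inE ug' /= -(E x) -(E y) mulKVmx.
by rewrite !inE => /andP[ug' gD]; rewrite unitmx_mul uh ug' !E.
Qed.

Lemma coinc_num_dim D x y x' y' :
  \dim x = \dim x' -> \dim y = \dim y' -> \dim (x :&: y) = \dim (x' :&: y') ->
  coinc_num D x y = coinc_num D x' y'.
Proof.
move=> dx dy dxy; have [g [ug <- <-]] := gl_trans2 dx dy dxy.
by rewrite coinc_num_gl.
Qed.

Lemma design_gl D t k lambda g : g \in unitmx -> subspace_design t k lambda D ->
  subspace_design t k lambda (gl_act g @: D).
Proof.
move=> ug [D0 dimD lamD]; split.
- by apply: contra D0; rewrite imset_eq0.
- by move=> _ /imsetP[V VD ->]; rewrite dim_gl_act // dimD.
move=> T dT; rewrite -(lamD (gl_act (invmx g) T)); last first.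
  by rewrite dim_gl_act ?unitmx_inv.
rewrite -[RHS](card_imset _ (gl_act_inj ug)); apply: eq_card => V.
apply/idP/imsetP => [|[W]].
  rewrite inE => /andP[/imsetP[W WD ->] TV]; exists W => //; rewrite inE WD /=.
  by rewrite -(sub_gl_act _ _ ug) gl_actVK.
rewrite !inE => /andP[WD TW] ->; rewrite imset_f //=.
by rewrite -(sub_gl_act _ _ ug) gl_actVK in TW.
Qed.

(** Put T = x :&: y. Among the subspaces y' of dimension k with x :&: y' = T, which
    are about q ^ (n (k - dim T)) in number, all have the same coincidence
    number with x by transitivity. Summing over them counts, for the translates
    that contain x, the blocks above T, of which there are at most
    lambda q ^ (n (t - dim T)). *)
Lemma coinc_num_bound D t k lambda x y : subspace_design t k lambda D -> t <= k ->
  2 * k < n -> \dim x = k -> \dim y = k ->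
  coinc_num D x y * q ^ (n * (k - maxn (\dim (x :&: y)) t))
    <= 2 * lambda * q ^ (k * k) * coinc_num D x x.
Proof.
move=> desD tk kn dx dy.
set T := (x :&: y)%VS; set s := \dim T; pose m := k - s.
have sk : s <= k by rewrite -dx dimvS // capvSl.
have smk : s + m = k by rewrite subnKC.
have Tx : (T <= x)%VS by exact: capvSl.
have q0 j : 0 < q ^ j by rewrite expn_gt0 ltnW.
(* Every frame w modulo x yields the partner T + colspan w of x, which meets x
   exactly in T. *)
have frE : #|frames x m| * coinc_num D x y
    = \sum_(w in frames x m) coinc_num D x (T + colspan w)%VS.
  rewrite -sum_nat_const; apply: eq_bigr => w /frames_span/(_ Tx)[dw cw].
  by apply: coinc_num_dim; rewrite ?dw ?cw // dy -smk.
have le1 : #|frames x m| * coinc_num D x y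
    <= coinc_num D x x * (lambda * q ^ (n * (t - s)) * q ^ (k * m)).
  rewrite frE.
  have cE z : coinc_num D x z = \sum_(g in unitmx | x \in gl_act g @: D) (z \in gl_act g @: D).
    rewrite /coinc_num -sum1_card big_mkcond [RHS]big_mkcond; apply: eq_bigr => g _.
    by rewrite inE; case: (g \in unitmx); case: (x \in _); case: (z \in _).
  under eq_bigr do rewrite cE.
  rewrite exchange_big.
  have -> : coinc_num D x x = #|[pred g in unitmx | x \in gl_act g @: D]|.
    by apply: eq_card => g; rewrite !inE andbb.
  rewrite -sum_nat_const leq_sum // => g /andP[ug xg].
  have desg := design_gl ug desD; have [_ dimg _] := desg.
  apply: leq_trans (_ : \sum_(V in [set V in gl_act g @: D | (T <= V)%VS])
    #|[set w : 'M[F]_(n, m) | (colspan w <= V)%VS]| <= _); last first.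
    apply: (@leq_trans (\sum_(V in [set V in gl_act g @: D | (T <= V)%VS]) q ^ (k * m))).
      apply: leq_sum => V; rewrite inE => /andP[VD _].
      by rewrite (leq_trans (card_colspan_sub _ _)) // dimg.
    by rewrite sum_nat_const leq_mul2r (design_above _ desg) ?orbT.
  under [leqRHS]eq_bigr do rewrite -sum1_card.
  rewrite (exchange_big_dep predT) //= big_mkcond leq_sum //= => w _.
  case: ifP => // _; case: (boolP (_ \in _)) => //= wD.
  rewrite (bigD1 (T + colspan w)%VS) //= ?inE ?wD ?addvSl ?addvSr //.
have le2 : q ^ (n * m) <= 2 * #|frames x m|.
  by apply: card_frames; rewrite dx; lia.
have split_m : n * m = n * (k - maxn s t) + n * (t - s).
  by rewrite -mulnDr; congr (_ * _); lia.
rewrite -(leq_pmul2r (q0 (n * (t - s)))) -mulnA -expnD -split_m.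
apply: (@leq_trans (coinc_num D x y * (2 * #|frames x m|))).
  by rewrite leq_mul.
rewrite mulnCA [coinc_num _ _ _ * _]mulnC.
apply: (leq_trans (leq_mul (leqnn 2) le1)).
have km : q ^ (k * m) <= q ^ (k * k) by rewrite leq_exp2l // leq_mul // leq_subr.
rewrite [leqRHS](_ : _ = 2 * (coinc_num D x x * (lambda * q ^ (n * (t - s)) * q ^ (k * k)))).
  by do 3![apply: leq_mul => //].
by ring.
Qed.

End DesignCounting.

Local Open Scope ring_scope.

(** * Operators with natural number kernels *)

Section Operators.
Variables (K : numFieldType) (F : finFieldType) (n : nat).
Local Notation P := (subspace F n).
Local Notation V := (VP K F n).
Implicit Types (f g : V) (x y z T S : P) (A : P -> P -> nat).

(** Kernels with natural number entries commute with conjugation, so the adjoint is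
    given by the transposed kernel. *)
Definition kop A f : V := [ffun y => \sum_x f x *+ A x y].

Lemma kop_is_linear A : linear (kop A).
Proof.
move=> a f g; apply/ffunP => y; rewrite !ffunE scaler_sumr -big_split.
by apply: eq_bigr => x _; rewrite !ffunE mulrnDl scalerMnr.
Qed.

HB.instance Definition _ A :=
  GRing.isLinear.Build K V V *:%R (kop A) (kop_is_linear A).

Lemma kop_comp A (B : P -> P -> nat) f :
  kop B (kop A f) = kop (fun x z => \sum_y A x y * B y z)%N f.
Proof.
apply/ffunP => z; rewrite !ffunE; under eq_bigr do rewrite ffunE -sumrMnl.
rewrite exchange_big; apply: eq_bigr => x _ /=.
by rewrite -sumrMnr; apply: eq_bigr => y _; rewrite mulrnA.
Qed.

Definition delta x : V := [ffun y => (y == x)%:R].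

Lemma span_delta (s : seq P) f :
  reflect (forall x, x \notin s -> f x = 0) (f \in <<map delta s>>%VS).
Proof.
apply: (iffP idP) => [fs x xs|f0].
  rewrite (coord_span (X := in_tuple _) fs) sum_ffunE big1 // => i _.
  have := mem_nth 0 (ltn_ord i); set u := nth _ _ _ => /mapP[z zs uz].
  by rewrite /= ffunE -/u uz ffunE; case: eqP zs xs => [<- ->|]; rewrite ?scaler0.
have -> : f = \sum_x f x *: delta x.
  apply/ffunP => y; rewrite sum_ffunE (bigD1 y) //= big1 => [|x xy].
    by rewrite !ffunE eqxx addr0 /= [RHS]mulr1.
  by rewrite !ffunE eq_sym (negPf xy) scaler0.
apply: memv_suml => x _; have [xs|/f0 ->] := boolP (x \in s).
  by apply/memvZ/memv_span/map_f.
by rewrite scale0r mem0v.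
Qed.

Lemma free_delta (s : seq P) : uniq s -> free (map delta s).
Proof.
elim: s => [|x s IHs] /=; first by rewrite nil_free.
case/andP=> xs us; rewrite free_cons IHs // andbT.
apply/span_delta => /(_ x xs)/eqP; rewrite ffunE eqxx; apply/negP.
exact: oner_neq0.
Qed.

Definition level r : {vspace V} := <<map delta (enum [set x | \dim x == r])>>%VS.

Lemma levelP r f : reflect (forall x, \dim x != r -> f x = 0) (f \in level r).
Proof.
by apply: (iffP (span_delta _ _)) => f0 x; have:= f0 x; rewrite mem_enum inE.
Qed.

Lemma dim_level r : \dim (level r) = #|[set x : P | \dim x == r]|.
Proof.
by rewrite (eqnP (free_delta (enum_uniq _))) size_map -cardE.
Qed.

Lemma level_eq0 r f x : f \in level r -> \dim x != r -> f x = 0.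
Proof. by move/levelP; apply. Qed.

Variable cj : {rmorphism K -> K}.
Hypothesis cjP : forall a, a * cj a = `|a| ^+ 2.

Definition dot f g : K := \sum_x (f x : K) * cj (g x).

Lemma dot_kop A f g : dot (kop A f) g = dot f (kop (fun x y => A y x) g).
Proof.
rewrite /dot; under eq_bigr do rewrite ffunE mulr_suml.
rewrite exchange_big; apply: eq_bigr => x _ /=.
rewrite ffunE rmorph_sum mulr_sumr; apply: eq_bigr => y _ /=.
by rewrite raddfMn mulrnAr mulrnAl.
Qed.

Lemma dotE f : dot f f = \sum_x `|f x : K| ^+ 2.
Proof. by apply: eq_bigr => x _; apply: cjP. Qed.

Lemma dot_ge0 f : 0 <= dot f f.
Proof. by rewrite dotE sumr_ge0 // => x _; rewrite exprn_ge0. Qed.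

Lemma dot_eq0 f : dot f f = 0 -> f = 0.
Proof.
rewrite dotE => /eqP; rewrite psumr_eq0 => [|x _]; last by rewrite exprn_ge0.
move/allP=> f0; apply/ffunP => x; rewrite ffunE; apply/eqP.
by have := f0 x (mem_index_enum x); rewrite /= expf_eq0 /= normr_eq0.
Qed.

Lemma dotDl f f' g : dot (f + f') g = dot f g + dot f' g.
Proof. by rewrite -big_split; apply: eq_bigr => x _; rewrite ffunE mulrDl. Qed.

Lemma dotZl a f g : dot (a *: f) g = a * dot f g.
Proof.
by rewrite mulr_sumr; apply: eq_bigr => x _; rewrite ffunE -mulrA.
Qed.

Lemma dot0l g : dot 0 g = 0.
Proof. by rewrite -(scale0r (0 : V)) dotZl mul0r. Qed.

Lemma dotMnl f g m : dot (f *+ m) g = dot f g *+ m.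
Proof. by rewrite -scaler_nat dotZl mulr_natl. Qed.

Lemma dotMnr f g m : dot f (g *+ m) = dot f g *+ m.
Proof.
rewrite -sumrMnl; apply: eq_bigr => x _.
by rewrite ffunMnE raddfMn mulrnAr.
Qed.

Definition kup := kop cov.
Definition kdown := kop (fun x y => cov y x).

(** [inc s] sums over the subspaces above, and [inc_tr s] over those below;
    both treat all ranks at once. *)
Definition inc s := kop (fun y T => below s T y).
Definition inc_tr s := kop (below s).

HB.instance Definition _ :=
  GRing.isLinear.Build K V V *:%R kup (kop_is_linear cov).
HB.instance Definition _ s :=
  GRing.isLinear.Build K V V *:%R (inc s) (kop_is_linear (fun y T => below s T y)).

End Operators.

(** * The up operator is injective below the middle *)
Section UpDown.
Variables (K : numFieldType) (F : finFieldType) (n : nat).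
Local Notation q := #|F|.
Local Notation P := (subspace F n).
Local Notation V := (VP K F n).
Implicit Types (f g : V) (x y z T S : P).

Let q1 : (1 < q)%N := q_gt1 F.

Lemma qXB_gt0 a b : (a < b)%N -> (0 < q ^ b - q ^ a)%N.
Proof. by move=> ab; rewrite subn_gt0 ltn_exp2l. Qed.

Lemma mulrn_neq0 (a : K) m : (0 < m)%N -> (a *+ m == 0) = (a == 0).
Proof. by rewrite mulrn_eq0 => /lt0n_neq0/negPf ->. Qed.

Lemma kup_level r f : f \in level K F n r -> kup f \in level K F n r.+1.
Proof.
move=> fr; apply/levelP => y dy; rewrite ffunE big1 // => x _.
have [dx|dx] := eqVneq (\dim x) r; last by rewrite (level_eq0 fr dx) mul0rn.
by rewrite /cov dx (negPf dy) andbF.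
Qed.

Definition kupn m : V -> V := iter m (@kup K F n).

Lemma kupnSr m f : kupn m.+1 f = kupn m (kup f).
Proof. exact: iterSr. Qed.

Fact kupn_is_linear m : linear (kupn m).
Proof. by move=> a f g; elim: m => //= m ->; exact: linearP. Qed.

HB.instance Definition _ m :=
  GRing.isLinear.Build K V V *:%R (kupn m) (kupn_is_linear m).

Lemma kupn_level m r f :
  f \in level K F n r -> kupn m f \in level K F n (r + m)%N.
Proof.
elim: m r f => [|m IHm] r f fr; first by rewrite addn0.
by rewrite kupnSr addnS -addSn; apply/IHm/kup_level.
Qed.

Lemma inc_level s f : inc s f \in level K F n s.
Proof.
apply/levelP => y dy; rewrite ffunE big1 // => x _.
by rewrite /below (negPf dy) andbF.
Qed.

Lemma inc0E f : inc 0 f 0%VS = \sum_x f x.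
Proof. by rewrite ffunE; apply: eq_bigr => x _; rewrite /below sub0v dimv0. Qed.

Lemma inc_tr_kup r f y : f \in level K F n r ->
  inc_tr r.+1 (kup f) y *+ (q ^ r.+1 - q ^ r) = inc_tr r f y *+ (q ^ \dim y - q ^ r).
Proof.
move=> fr; rewrite /inc_tr /kup kop_comp !ffunE -!sumrMnl; apply: eq_bigr => x _.
have [dx|dx] := eqVneq (\dim x) r; last by rewrite (level_eq0 fr dx) !mul0rn.
by rewrite -!mulrnA sum_cov_below.
Qed.

Lemma kdown_inc k r f S : f \in level K F n k -> \dim S = r ->
  kdown (inc r.+1 f) S *+ (q ^ r.+1 - q ^ r) = inc r f S *+ (q ^ k - q ^ r).
Proof.
move=> fk dS; rewrite /inc /kdown kop_comp !ffunE -!sumrMnl; apply: eq_bigr => y _.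
have [dy|dy] := eqVneq (\dim y) k; last by rewrite (level_eq0 fk dy) !mul0rn.
rewrite -!mulrnA -dy -sum_cov_below //; congr (_ *+ (_ * _)).
by apply: eq_bigr => z _; rewrite mulnC.
Qed.

(** By [kdown_inc], summing [inc s.+1 f] over the covers of S gives a non-zero
    multiple of [inc s f] at S. *)
Lemma inc_eq0_le k s m f : f \in level K F n k -> (s + m <= k)%N ->
  inc (s + m)%N f = 0 -> inc s f = 0.
Proof.
move=> fk; elim: m => [|m IHm]; first by rewrite addn0 => _ ->.
rewrite addnS => smk f0.
apply: (IHm (ltnW smk)); apply/ffunP => S; rewrite [RHS]ffunE; apply/eqP.
have [dS|dS] := eqVneq (\dim S) (s + m)%N; last by rewrite (level_eq0 (inc_level _ _) dS).
have := kdown_inc fk dS; rewrite f0 /kdown linear0 ffunE mul0rn => /esym/eqP.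
by rewrite mulrn_neq0 // qXB_gt0.
Qed.

(** The power of the up operator counts each inclusion T <= y with the number of
    maximal chains in between. The two factors a and b stand for that rational
    number, so that no division is needed. *)
Lemma kupn_inc_tr t m : exists a b : nat, [/\ (0 < a)%N, (0 < b)%N &
  forall f y, f \in level K F n t -> \dim y = (t + m)%N ->
    kupn m f y *+ a = inc_tr t f y *+ b].
Proof.
elim: m t => [|m IHm] t.
  exists 1, 1%N; split=> // f y ft; rewrite addn0 => dy; rewrite ffunE /= !mulr1n.
  rewrite (bigD1 y) //= big1 => [|x xy].
    by rewrite /below subvv dy eqxx addr0.
  rewrite /below; case: andP => // -[xsy /eqP dx]; case/negP: xy.
  by rewrite eqEdim xsy dx dy /=.
have [a [b [a0 b0 IH]]] := IHm t.+1.
exists (a * (q ^ t.+1 - q ^ t))%N, (b * (q ^ (t + m.+1) - q ^ t))%N; split.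
- by rewrite muln_gt0 a0 qXB_gt0.
- by rewrite muln_gt0 b0 qXB_gt0 // -addSnnS ltn_addr.
move=> f y ft dy; rewrite kupnSr mulrnA IH ?kup_level //; last by rewrite dy addnS.
by rewrite mulrnAC inc_tr_kup // dy mulnC mulrnA.
Qed.

Section Injectivity.
Variable cj : {rmorphism K -> K}.
Hypothesis cjP : forall a, a * cj a = `|a| ^+ 2.
Local Notation dot := (dot cj).

(** The commutator kdown kup - kup kdown is diagonal, and on rank r < n / 2 it is
    positive, so |kup f|^2 exceeds |kdown f|^2 unless f = 0. *)
Lemma kup_inj r f : (r < n - r)%N -> f \in level K F n r -> kup f = 0 -> f = 0.
Proof.
move=> rn fr f0.
(* As kup f = 0, the commutator of kup and kdown makes f an eigenvector of
   kup kdown, of negative eigenvalue -c / (q - 1). *)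
pose c := (q ^ (n - r) - q ^ r)%N.
have E : kup (kdown f) *+ (q - 1) = - (f *+ c).
  apply/ffunP => z; rewrite ffunMnE [RHS]ffunE ffunMnE; apply/eqP.
  have : kdown (kup f) z *+ (q - 1) = 0 by rewrite f0 /kdown linear0 ffunE mul0rn.
  rewrite /kdown /kup !kop_comp !ffunE -!sumrMnl => up0.
  rewrite -subr_eq0 opprK -[X in _ == X]up0 (bigD1 z) //= [X in _ == X](bigD1 z) //=.
  rewrite addrAC; apply/eqP; congr (_ + _); last first.
    by apply: eq_bigr => x xz; rewrite cov_cov_off.
  have [dz|dz] := eqVneq (\dim z) r; last by rewrite (level_eq0 fr dz) !mul0rn addr0.
  have sq1 : (\sum_y cov y z * cov y z = \sum_y cov y z)%N.
    by apply: eq_bigr => y _; rewrite /cov; case: (_ && _).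
  have sq2 : (\sum_y cov z y * cov z y = \sum_y cov z y)%N.
    by apply: eq_bigr => y _; rewrite /cov; case: (_ && _).
  by rewrite sq1 sq2 -!mulrnA -mulrnDr -(card_covers_diff dz (ltnW rn)).
have dE : dot (kup (kdown f)) f = dot (kdown f) (kdown f).
  by rewrite /kup dot_kop.
apply: (dot_eq0 cjP); apply/eqP; rewrite eq_le (dot_ge0 cjP) andbT.
have c0 : (0 < c)%N by exact: qXB_gt0.
rewrite -(pmulrn_lle0 _ c0) -dotMnl -[f *+ c]opprK -E -scaleN1r dotZl dotMnl dE.
by rewrite mulN1r oppr_le0 mulrn_wge0 // (dot_ge0 cjP).
Qed.

Lemma kupn_inj r m f : (2 * (r + m) <= n)%N -> f \in level K F n r ->
  kupn m f = 0 -> f = 0.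
Proof.
elim: m r f => [|m IHm] r f rn fr //; rewrite kupnSr => f0.
apply: (@kup_inj r) => //; first by lia.
by apply: (IHm r.+1) => //; [lia | exact: kup_level].
Qed.

(** With u the power k - t of the up operator, <inc t (u g), g> is a positive
    multiple of |u g|^2, so the endomorphism g |-> inc t (u g) of rank t is
    injective, hence onto. *)
Lemma inc_onto t k : (t <= k)%N -> (2 * k <= n)%N ->
  (linfun (inc t) @: level K F n k = level K F n t)%VS.
Proof.
move=> tk kn; have tmk : (t + (k - t) = k)%N by rewrite subnKC.
have [a [b [a0 b0 ab]]] := kupn_inc_tr t (k - t).
pose u := kupn (k - t).
have u_level g : g \in level K F n t -> u g \in level K F n k.
  by move/(kupn_level (k - t)); rewrite tmk.
have sub : (linfun (inc t) @: level K F n k <= level K F n t)%VS.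
  by apply/subvP => _ /memv_imgP[f _ ->]; rewrite lfunE inc_level.
pose Z := (linfun (inc t) \o linfun u : 'End(V))%VF.
have Zinj : (level K F n t :&: lker Z = 0)%VS.
  apply/eqP; rewrite -subv0; apply/subvP => g /memv_capP[gt].
  rewrite memv_ker comp_lfunE !lfunE memv0 => /eqP Zg.
  apply/eqP/(@kupn_inj t (k - t)) => //; first by rewrite tmk.
  apply: (dot_eq0 cjP); apply/eqP; rewrite -(mulrn_neq0 _ a0) -dotMnr.
  have <- : dot (u g) (inc_tr t g *+ b) = dot (u g) (u g *+ a).
    apply: eq_bigr => y _; rewrite !ffunMnE.
    have [dy|dy] := eqVneq (\dim y) k; last by rewrite (level_eq0 (u_level _ gt) dy) !mul0r.
    by rewrite ab // tmk.
  rewrite dotMnr mulrn_neq0 //.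
  have := dot_kop cj (fun y T => below t T y) (u g) g.
  rewrite -/(inc t) [inc t _]Zg => E.
  by rewrite /inc_tr -E dot0l.
apply/eqP; rewrite eqEdim sub -(limg_dim_eq Zinj) dimvS //.
rewrite limg_comp limgS //; apply/subvP => _ /memv_imgP[g gt ->].
by rewrite lfunE u_level.
Qed.

End Injectivity.
End UpDown.

(** * The coincidence form on the kernel of the incidence map *)

Section Triangular.
Variables (R : realFieldType) (a : nat -> nat -> R).
Hypothesis a1 : forall i, a i i = 1.

Lemma triangular_ex (c : nat -> R) m : exists b : nat -> R,
  forall i, (i < m)%N -> c i = \sum_(s < i.+1) b s * a i s.
Proof.
elim: m => [|m [b bE]]; first by exists c.
exists (fun s => if s == m then c m - \sum_(s < m) b s * a m s else b s) => i.
have restr l j : (j <= m)%N ->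
  \sum_(s < j) (if s == m :> nat then c m - \sum_(s < m) b s * a m s else b s) * a l s
  = \sum_(s < j) b s * a l s.
  by move=> jm; apply: eq_bigr => s _; rewrite ltn_eqF // (leq_trans _ jm).
rewrite ltnS leq_eqVlt => /predU1P[->|im]; last by rewrite restr // bE.
by rewrite big_ord_recr /= restr // eqxx a1 mulr1 addrC subrK.
Qed.

Variables (gam : R) (k : nat) (b c e : nat -> R).
Hypothesis a_le : forall i s, (i <= k)%N -> (s <= i)%N -> `|a i s| <= gam.
Hypothesis bE : forall i, (i <= k)%N -> c i = \sum_(s < i.+1) b s * a i s.
Hypothesis e_ge0 : forall i, 0 <= e i.
Hypothesis e_mono : forall i j, (i <= j)%N -> e i <= e j.
Hypothesis c_le : forall i, (i <= k)%N -> `|c i| <= e i.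

(** One step of forward substitution: if the earlier b s are controlled by a
    geometric progression of ratio 1 + gam, so is the correction b i - c i. *)
Lemma triangular_step i m : (i <= k)%N ->
  (forall s, (s < i)%N -> (s <= m)%N /\ `|b s| <= (1 + gam) ^+ s * e s) ->
  `|b i - c i| <= ((1 + gam) ^+ i - 1) * e m.
Proof.
move=> ik IH; have gam0 : 0 <= gam by rewrite (le_trans _ (a_le (leq0n k) (leqnn 0))).
have -> : b i - c i = - \sum_(s < i) b s * a i s.
  by rewrite bE // big_ord_recr /= a1 mulr1 opprD addrCA subrr addr0.
rewrite normrN (le_trans (ler_norm_sum _ _ _)) //.
rewrite subrX1 addrAC subrr add0r mulrAC mulr_sumr ler_sum // => s _.
have [sm bs] := IH s (ltn_ord s).
rewrite normrM mulrC -mulrA ler_pM // ?a_le // 1?ltnW //.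
rewrite mulrC (le_trans bs) // ler_wpM2l ?e_mono // exprn_ge0 //.
by rewrite addr_ge0.
Qed.

Lemma triangular_bound i : (i <= k)%N -> `|b i| <= (1 + gam) ^+ i * e i.
Proof.
elim/ltn_ind: i => i IH ik.
have : `|b i - c i| <= ((1 + gam) ^+ i - 1) * e i.
  apply: triangular_step => // s si; split; first exact: ltnW.
  by apply: IH; rewrite // (leq_trans (ltnW si)).
rewrite mulrBl mul1r => le1; rewrite -[b i](subrK (c i)).
by rewrite (le_trans (ler_normD _ _)) // (le_trans (lerD le1 (c_le ik))) // subrK.
Qed.

(** A one-sided bound with the previous value of e: when c i.+1 >= 0, the
    coefficient b i.+1 can only be negative to the order e i, which is much
    smaller than e i.+1 in the application. *)
Lemma triangular_lower i : (i < k)%N -> c i.+1 - (1 + gam) ^+ k * e i <= b i.+1.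
Proof.
move=> ik; have gam0 : 0 <= gam by rewrite (le_trans _ (a_le (leq0n k) (leqnn 0))).
have le1 : `|b i.+1 - c i.+1| <= ((1 + gam) ^+ i.+1 - 1) * e i.
  apply: triangular_step => // s si; split=> //.
  by apply: triangular_bound; apply: leq_trans ik; rewrite ltnW.
rewrite lerBlDr -lerBlDl.
rewrite (le_trans (ler_norm _)) // distrC (le_trans le1) // ler_wpM2r //.
rewrite lerBlDr (le_trans (ler_weXn2l _ ik)) ?lerDl //.
Qed.

End Triangular.

Section PositiveDefinite.
Variables (K : numFieldType) (cj : {rmorphism K -> K}).
Hypothesis cjP : forall a, a * cj a = `|a| ^+ 2.
Variables (F : finFieldType) (n : nat).
Local Notation q := #|F|.
Local Notation P := (subspace F n).
Local Notation V := (VP K F n).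
Local Notation dot := (dot cj).
Implicit Types (f g : V) (x y z T S : P).

Let q1 : (1 < q)%N := q_gt1 F.

Lemma sum_sqr_le (I : finType) (A : pred I) (a : I -> K) :
  (forall i, 0 <= a i) ->
  (\sum_(i | A i) a i) ^+ 2 <= #|A|%:R * \sum_(i | A i) a i ^+ 2.
Proof.
move=> a0; rewrite -(ler_pMn2r (isT : (0 < 2)%N)) expr2 big_distrlr /=.
apply: (@le_trans _ _ (\sum_(i | A i) \sum_(j | A j) (a i ^+ 2 + a j ^+ 2))).
  rewrite -sumrMnl ler_sum // => i _; rewrite -sumrMnl ler_sum // => j _.
  have /leifP := real_leif_mean_square_scaled (ger0_real (a0 i)) (ger0_real (a0 j)).
  by case: eqP => [-> _ | _ /ltW //]; rewrite -expr2 mulr2n.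
have -> : \sum_(i | A i) \sum_(j | A j) (a i ^+ 2 + a j ^+ 2)
    = \sum_(i | A i) (#|A|%:R * a i ^+ 2 + \sum_(j | A j) a j ^+ 2).
  by apply: eq_bigr => i _; rewrite big_split /= sumr_const mulr_natl.
by rewrite big_split /= -mulr_sumr sumr_const -[X in _ + X]mulr_natl -mulr2n.
Qed.

(** Cauchy-Schwarz at each T, which lies below at most q ^ (n (k - s)) subspaces of
    dimension k; each of these contains [gbin q k s] subspaces of dimension s. *)
Lemma inc_norm k s f : f \in level K F n k -> (s <= k)%N ->
  dot (inc s f) (inc s f) <= (gbin q k s * q ^ (n * (k - s)))%:R * dot f f.
Proof.
move=> fk sk; pose A T := [pred y : P | (T <= y)%VS && (\dim y == k)].
have incE T : \dim T = s -> inc s f T = \sum_(y | A T y) f y.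
  move=> dT; rewrite ffunE [RHS]big_mkcond; apply: eq_bigr => y _ /=.
  rewrite /below dT eqxx andbT; have [dy|dy] := eqVneq (\dim y) k; last first.
    by rewrite (level_eq0 fk dy) mul0rn andbF.
  by case: (T <= y)%VS.
have cardA T : \dim T = s -> (#|A T| <= q ^ (n * (k - s)))%N.
  move=> dT; apply: leq_trans (card_superspaces T (k - s)).
  by apply/subset_leq_card/subsetP => y; rewrite !inE dT subnKC.
rewrite !dotE //.
apply: (@le_trans _ _ (\sum_(T : P | \dim T == s) (q ^ (n * (k - s)))%:R *
   \sum_(y | A T y) `|f y : K| ^+ 2)).
  rewrite [leRHS]big_mkcond ler_sum // => T _.
  case: eqP => [dT|/eqP dT]; last by rewrite (level_eq0 (inc_level _ _) dT) normr0 expr0n.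
  rewrite incE // (le_trans (_ : _ <= (\sum_(y | A T y) `|f y : K|) ^+ 2)) //.
    by rewrite ler_sqr ?nnegrE ?sumr_ge0 // ler_norm_sum.
  rewrite (le_trans (sum_sqr_le _ _)) // ler_wpM2r ?ler_nat ?cardA //.
  by rewrite sumr_ge0 // => y _; rewrite exprn_ge0.
rewrite -mulr_sumr [(gbin _ _ _ * _)%N]mulnC natrM -mulrA ler_wpM2l // mulr_sumr.
rewrite (exchange_big_dep predT) //= ler_sum // => y _.
have [dy|dy] := eqVneq (\dim y) k; last first.
  by rewrite (level_eq0 fk dy) normr0 expr0n /= mulr0 big1.
rewrite (eq_bigl (mem [set T : P | (T <= y)%VS & \dim T == s])) => [|T]; last first.
  by rewrite !inE andbT andbC.
by rewrite sumr_const card_subspaces dy mulr_natl.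
Qed.

Lemma inc_self k f : f \in level K F n k -> inc k f = f.
Proof.
move=> fk; apply/ffunP => y; have [dy|dy] := eqVneq (\dim y) k; last first.
  by rewrite (level_eq0 fk dy) (level_eq0 (inc_level _ _) dy).
rewrite ffunE (bigD1 y) //= /below subvv dy eqxx big1 ?addr0 // => x xy.
have [dx|dx] := eqVneq (\dim x) k; last by rewrite (level_eq0 fk dx) mul0rn.
rewrite andbT; case: (boolP (y <= x)%VS) => // yx; case/negP: xy.
by rewrite eq_sym eqEdim yx dx dy /=.
Qed.

(** The Gaussian binomial of dim (x :&: y) counts the common subspaces of
    dimension s, so it is the kernel of the adjoint of [inc s] after [inc s]. *)
Lemma dot_kop_expand k (N : P -> P -> nat) (b : nat -> rat) f :
  f \in level K F n k ->
  (forall x y, \dim x = k -> \dim y = k ->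
    (N x y)%:R = \sum_(s < k.+1) b s * (gbin q (\dim (x :&: y)) s)%:R) ->
  dot (kop N f) f = \sum_(s < k.+1) ratr (b s) * dot (inc s f) (inc s f).
Proof.
move=> fk NE.
have incE s : dot (inc s f) (inc s f) =
    \sum_y \sum_x (f x : K) * cj (f y) * (gbin q (\dim (x :&: y)) s)%:R.
  rewrite {1}/inc dot_kop kop_comp [RHS]exchange_big; apply: eq_bigr => x _ /=.
  rewrite ffunE rmorph_sum mulr_sumr; apply: eq_bigr => y _.
  rewrite raddfMn -[X in _ * X = _]mulr_natr mulrA; congr (_ * _%:R).
  rewrite -card_subspaces -sum1_card [RHS]big_mkcond; apply: eq_bigr => T _.
  by rewrite inE subv_cap /below; case: (T <= x)%VS; case: (T <= y)%VS; case: (_ == _).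
under [RHS]eq_bigr do rewrite incE mulr_sumr.
rewrite exchange_big; apply: eq_bigr => y _ /=.
rewrite ffunE mulr_suml.
under [RHS]eq_bigr do rewrite mulr_sumr.
rewrite exchange_big; apply: eq_bigr => x _ /=.
have [dx|dx] := eqVneq (\dim x) k; last first.
  by rewrite (level_eq0 fk dx) mul0rn mul0r big1 // => s _; rewrite !(mul0r, mulr0).
have [dy|dy] := eqVneq (\dim y) k; last first.
  by rewrite (level_eq0 fk dy) rmorph0 mulr0 big1 // => s _; rewrite !(mul0r, mulr0).
have := congr1 (@ratr K) (NE x y dx dy); rewrite ratr_nat rmorph_sum /= => E.
rewrite -[_ *+ _]mulr_natr mulrAC E mulr_sumr; apply: eq_bigr => s _.
by rewrite rmorphM /= ratr_nat mulrCA.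
Qed.

Variables (t k lambda : nat) (D : {set P}).
Hypotheses (tk : (t < k)%N) (desD : subspace_design t k lambda D).

Lemma coinc_num_id_gt0 x : x \in D -> (0 < coinc_num D x x)%N.
Proof.
move=> xD; apply/card_gt0P; exists 1%:M; rewrite inE unitmx1 andbb.
by rewrite mem_gl_actS ?unitmx1 // invmx1 gl_act1.
Qed.

Lemma coinc_num_class : exists c : nat -> nat, forall x y,
  \dim x = k -> \dim y = k -> coinc_num D x y = c (\dim (x :&: y)).
Proof.
(* any pair of the right type serves as representative *)
pose isp i := [pred p : P * P | [&& \dim p.1 == k, \dim p.2 == k & \dim (p.1 :&: p.2) == i]].
exists (fun i => if [pick p | isp i p] is Some p then coinc_num D p.1 p.2 else 0%N).
move=> x y dx dy; case: pickP => [[x' y'] /and3P[/= /eqP dx' /eqP dy' /eqP dxy']|/(_ (x, y))].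
  by apply: coinc_num_dim; rewrite ?dx ?dy ?dxy'.
by rewrite /= dx dy !eqxx.
Qed.

End PositiveDefinite.

(** A crude bound for all Gaussian binomials that occur, independent of n. *)
Definition gsum (q k : nat) : nat := \sum_(i < k.+1) \sum_(s < k.+1) gbin q i s.

Lemma gbin_le_gsum q k i s : (i <= k)%N -> (s <= k)%N -> (gbin q i s <= gsum q k)%N.
Proof.
move=> ik sk; rewrite /gsum (bigD1 (inord i)) //= (bigD1 (inord s)) //=.
by rewrite !inordK ?ltnS // -addnA leq_addr.
Qed.

(** The constant of [coinc_num_bound], multiplied by the growth factor of the
    triangular system. *)
Definition bound_const (q k lambda : nat) : nat :=
  ((1 + gsum q k) ^ k * (2 * lambda * q ^ (k * k)))%N.

(** The first summand makes q ^ n exceed the constant of the total error: 1 comes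
    from the term s = k, and k * gsum from those with s < k. The rest ensures
    2k < n. *)
Definition threshold (q k lambda : nat) : nat :=
  (bound_const q k lambda * (1 + k * gsum q k) + 2 * k + 1)%N.

Section Definite.
Variables (F : finFieldType) (n : nat).
Local Notation q := #|F|.
Local Notation P := (subspace F n).
Variables (t k lambda : nat) (D : {set P}).
Hypotheses (tk : (t < k)%N) (desD : subspace_design t k lambda D).
Hypothesis n_large : (threshold q k lambda <= n)%N.

Let q1 : (1 < q)%N := q_gt1 F.

Let A : nat := (2 * lambda * q ^ (k * k))%N.
Let gam : nat := gsum q k.
Let B : nat := bound_const q k lambda.
Let Q : rat := (q ^ n)%:R.

Let Q_gt0 : 0 < Q.
Proof. by rewrite ltr0n expn_gt0 ltnW. Qed.

Let Q_large : (B * (1 + k * gam))%:R < Q.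
Proof.
rewrite ltr_nat (leq_ltn_trans _ (ltn_expl n q1)) // (leq_trans _ n_large) //.
by rewrite /threshold -addnA leq_addr.
Qed.

(** The coefficients of N in terms of the Gram matrices of the incidence maps.
    Only the lower bounds matter, since these Gram matrices are positive. *)
Lemma coinc_num_coeffs x : x \in D -> exists b : nat -> rat,
  [/\ forall y z, \dim y = k -> \dim z = k -> (coinc_num D y z)%:R
        = \sum_(s < k.+1) b s * (gbin q (\dim (y :&: z)) s)%:R,
      forall s, (t < s)%N -> (s <= k)%N ->
        - (B%:R * (coinc_num D x x)%:R / Q ^+ (k - s).+1) <= b s
    & (coinc_num D x x)%:R * (1 - B%:R / Q) <= b k].
Proof.
move=> xD; have dx : \dim x = k by have [_ dimD _] := desD; apply: dimD.
set N0 : rat := (coinc_num D x x)%:R.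
have kn : (2 * k < n)%N by move: n_large; rewrite /threshold; lia.
have [c cE] := coinc_num_class k D.
pose a i s : rat := (gbin q i s)%:R.
have a1 i : a i i = 1 by rewrite /a gbinnn.
(* Dimensions that are not attained by an intersection get the value 0: the
   representative c i would be uncontrolled there. *)
pose c' (i : nat) : rat := if [exists p : P * P, [&& \dim p.1 == k, \dim p.2 == k &
  \dim (p.1 :&: p.2) == i]] then (c i)%:R else 0.
pose e i : rat := A%:R * N0 / Q ^+ (k - maxn i t).
have Q1 : 1 <= Q by rewrite ler1n expn_gt0 ltnW.
have N0_ge0 : 0 <= N0 by rewrite ler0n.
have e0 i : 0 <= e i by rewrite divr_ge0 ?mulr_ge0 ?exprn_ge0 ?ler0n.
have emono i j : (i <= j)%N -> e i <= e j.
  move=> ij; rewrite ler_wpM2l ?mulr_ge0 // lef_pV2 ?posrE ?exprn_gt0 //.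
  by rewrite ler_weXn2l // leq_sub2l // geq_max !leq_max ij leqnn !orbT.
have c_le i : `|c' i| <= e i.
  rewrite /c'; case: existsP => [[[y z] /and3P[/= /eqP dy /eqP dz /eqP di]]|_]; last first.
    by rewrite normr0.
  rewrite normr_nat -di -cE // ler_pdivlMr ?exprn_gt0 // /Q -natrX -!natrM ler_nat.
  have -> : coinc_num D x x = coinc_num D y y.
    by apply: coinc_num_dim; rewrite ?capvv dx.
  rewrite -expnM.
  exact: (coinc_num_bound desD (ltnW tk) kn dy dz).
have [b bE] := triangular_ex a1 c' k.+1.
have bE' : forall j, (j <= k)%N -> c' j = \sum_(s < j.+1) b s * a j s.
  by move=> j jk; apply: bE.
have a_le : forall i s, (i <= k)%N -> (s <= i)%N -> `|a i s| <= gam%:R.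
  move=> i s ik si; rewrite normr_nat ler_nat gbin_le_gsum //.
  exact: leq_trans si ik.
have low := triangular_lower a1 a_le bE' e0 emono (fun i _ => c_le i).
have BE i : (t <= i)%N -> (1 + gam%:R) ^+ k * e i = B%:R * N0 / Q ^+ (k - i).
  by move=> ti; rewrite /e (maxn_idPl ti) !mulrA /B /bound_const natrM natrX natrD.
exists b; split.
- move=> y z dy dz; rewrite cE //; set i := \dim (y :&: z).
  have ik : (i <= k)%N by rewrite -dy dimvS // capvSl.
  have -> : (c i)%:R = c' i.
    rewrite /c'; case: existsP => // -[]; exists (y, z).
    by rewrite /= dy dz !eqxx.
  rewrite bE' // [RHS](bigID (fun s : 'I_k.+1 => (s < i.+1)%N)) /=.
  rewrite [X in _ + X]big1 => [|s]; last by rewrite -ltnNge => si; rewrite gbin_small // mulr0.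
  by rewrite addr0 (big_ord_widen k.+1 (fun s => b s * a i s)).
- move=> [|s] // ts sk; apply: le_trans (low s sk).
  by rewrite BE // subnSK // lerDr /c'; case: ifP.
have kK : k.-1.+1 = k by rewrite prednK // (leq_ltn_trans _ tk).
have ck : c' k = N0.
  rewrite /c' /N0 cE // capvv dx; case: existsP => // -[]; exists (x, x).
  by rewrite /= capvv dx !eqxx.
have := low k.-1; rewrite kK leqnn => /(_ isT); apply: le_trans.
have tk1 : (t <= k.-1)%N by rewrite -ltnS kK.
have k1 : (k - k.-1)%N = 1%N by rewrite -{1}kK subSnn.
rewrite BE // ck k1 mulrBr mulr1.
by rewrite expr1 mulrA [N0 * _]mulrC.
Qed.

Section Form.
Variables (K : numFieldType) (cj : {rmorphism K -> K}).
Hypothesis cjP : forall a, a * cj a = `|a| ^+ 2.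
Local Notation V := (VP K F n).
Local Notation dot := (dot cj).

(** In <N f, f> = sum_s b_s |W_s f|^2, the term s = k is (1 - O(q^-n)) c_k |f|^2, and
    each other term is at least -eps |f|^2 with eps = O(q^-n) c_k. *)
Lemma coinc_num_definite (f : V) : f \in level K F n k -> inc t f = 0 ->
  kop (coinc_num D) f = 0 -> f = 0.
Proof.
move=> fk f0 Nf0; have [D0 dimD _] := desD; have /set0Pn[x xD] := D0.
have [b [bE b_lo bk_lo]] := coinc_num_coeffs xD.
set N0 : rat := (coinc_num D x x)%:R in b_lo bk_lo.
have N0_gt0 : 0 < N0 by rewrite ltr0n coinc_num_id_gt0.
have := dot_kop_expand cj fk bE; rewrite Nf0 dot0l big_ord_recr /= inc_self //.
pose eps : rat := B%:R * gam%:R * N0 / Q.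
have d0 := dot_ge0 cjP; set d := dot f f.
have Qn0 : Q != 0 by rewrite gt_eqF.
have eps_ge0 : 0 <= eps by rewrite /eps divr_ge0 ?mulr_ge0 ?ler0n // ltW.
have term (s : 'I_k) : - (ratr eps * d) <= ratr (b s) * dot (inc s f) (inc s f).
  have [st|ts] := leqP s t.
    rewrite (@inc_eq0_le _ _ _ k s (t - s) f) ?subnKC ?(ltnW tk) //.
    by rewrite dot0l mulr0 oppr_le0; apply: mulr_ge0; rewrite ?ler0q ?d0.
  apply: le_trans (_ : - (ratr (B%:R * N0 / Q ^+ (k - s).+1) * dot (inc s f) (inc s f)) <= _).
    rewrite lerN2 (le_trans (ler_wpM2l _ (inc_norm cjP fk (ltnW (ltn_ord s))))) //.
      by rewrite ler0q divr_ge0 ?mulr_ge0 ?ler0n // ?ltW // exprn_gt0.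
    rewrite mulrA ler_wpM2r // -(ratr_nat K) -rmorphM ler_rat natrM expnM natrX -/Q.
    have Qs0 : Q ^+ (k - s) != 0 by rewrite expf_neq0.
    have -> : B%:R * N0 / Q ^+ (k - s).+1 * ((gbin q k s)%:R * Q ^+ (k - s))
        = B%:R * (gbin q k s)%:R * N0 / Q by rewrite exprS; field; apply/andP.
    have Qi0 : 0 <= Q^-1 by rewrite invr_ge0 ltW.
    rewrite /eps ler_wpM2r // ler_wpM2r ?(ltW N0_gt0) // ler_wpM2l //.
    by rewrite ler_nat gbin_le_gsum // ltnW.
  by rewrite -mulNr ler_wpM2r // -rmorphN ler_rat b_lo // ltnW.
move/esym/eqP; rewrite addr_eq0 => /eqP sumE.
apply: (dot_eq0 cjP); apply/eqP; rewrite eq_le d0 andbT -/d.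
have sum_lo : - (ratr eps * d *+ k) <= \sum_(s < k) ratr (b s) * dot (inc s f) (inc s f).
  rewrite -mulNrn -[k in _ *+ k]card_ord -sumr_const ler_sum //.
have coef : 0 < b k - eps *+ k.
  rewrite subr_gt0 (lt_le_trans _ bk_lo) // -[eps *+ k]mulr_natl /eps.
  have -> : k%:R * (B%:R * gam%:R * N0 / Q) = N0 * (1 - B%:R / Q)
      - N0 / Q * (Q - (B * (1 + k * gam))%:R) by rewrite !(natrM, natrD); field.
  by rewrite ltrBlDr ltrDl mulr_gt0 ?subr_gt0 // divr_gt0.
have : ratr (b k - eps *+ k) * d <= 0.
  rewrite rmorphB raddfMn mulrBl mulrnAl subr_le0.
  by rewrite -[_ *+ k]opprK lerNr -sumE.
by rewrite pmulr_rle0 // ltr0q.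
Qed.

End Form.

End Definite.

(** * The span of the orbit of a design *)

(** The powers of q in the factors q^d - q^i cancel. *)
Lemma gbin_gauss_binom (F : finFieldType) n k : (k <= n)%N ->
  (gbin #|F| n k)%:R = gauss_binom #|F| n k.
Proof.
move=> kn; have q1 := q_gt1 F; have q0 : (0 < #|F|)%N by exact: ltnW.
have prodE d : (k <= d)%N -> (\prod_(i < k) (#|F| ^ d - #|F| ^ i))%:R
    = \prod_(i < k) #|F|%:R ^+ i * \prod_(i < k) (#|F|%:R ^+ (d - i) - 1) :> rat.
  move=> kd; rewrite -big_split natr_prod; apply: eq_bigr => i _ /=.
  have id : (i <= d)%N by rewrite (leq_trans (ltnW (ltn_ord i))).
  rewrite natrB ?leq_pexp2l // !natrX mulrBr mulr1 -exprD subnKC //.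
have := congr1 (fun m => m%:R : rat) (gbin_mul F n k).
rewrite natrM !prodE // mulrCA => /mulfI mul_eq.
rewrite /gauss_binom -mul_eq ?mulfK //.
  apply/prodf_neq0 => i _; rewrite subr_eq0 -natrX pnatr_eq1 gtn_eqF //.
  by rewrite -{1}(expn0 #|F|) ltn_exp2l // subn_gt0 ltn_ord.
by apply/prodf_neq0 => i _; rewrite expf_neq0 // pnatr_eq0 -lt0n.
Qed.

Section Span.
Variables (K : numFieldType) (cj : {rmorphism K -> K}).
Hypothesis cjP : forall a, a * cj a = `|a| ^+ 2.
Variables (F : finFieldType) (n : nat).
Local Notation q := #|F|.
Local Notation P := (subspace F n).
Local Notation V := (VP K F n).
Variables (t k lambda : nat) (D : {set P}).
Hypothesis tk : (t < k)%N.
Hypothesis (desD : subspace_design t k lambda D).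
Hypothesis n_large : (threshold q k lambda <= n)%N.
Implicit Types (f : V) (g : 'M[F]_n).

Definition rank_one r : V := [ffun x : P => (\dim x == r)%:R].
(** The space E0 of the introduction. *)
Definition design_kernel : {vspace V} := (level K F n k :&: lker (linfun (inc t)))%VS.
Local Notation E0 := design_kernel.
Local Notation S := (orbit_span K D).

Lemma design_kernelP f : reflect (f \in level K F n k /\ inc t f = 0) (f \in E0).
Proof.
rewrite memv_cap memv_ker lfunE /=.
by apply: (iffP andP) => -[fk /eqP f0].
Qed.

Lemma two_k_le_n : (2 * k <= n)%N.
Proof. by move: n_large; rewrite /threshold; lia. Qed.

Lemma rank_one_level r : rank_one r \in level K F n r.
Proof. by apply/levelP => x dx; rewrite ffunE (negPf dx). Qed.

Lemma charvec_level g : g \in unitmx ->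
  charvec K (gl_act g @: D) \in level K F n k.
Proof.
move=> ug; have [_ dimg _] := design_gl ug desD.
apply/levelP => x dx; rewrite ffunE; case: (boolP (x \in _)) => // xD.
by rewrite dimg ?eqxx in dx.
Qed.

Lemma inc_charvec g : g \in unitmx ->
  inc t (charvec K (gl_act g @: D)) = lambda%:R *: rank_one t.
Proof.
move=> ug; have [_ dimg lamg] := design_gl ug desD.
apply/ffunP => T; rewrite !ffunE.
have [dT|dT] := eqVneq (\dim T) t; last first.
  by rewrite scaler0 big1 // => x _; rewrite /below (negPf dT) andbF.
rewrite -(lamg T dT) -sum1_card natr_sum scaler_suml [RHS]big_mkcond.
apply: eq_bigr => x _; rewrite inE ffunE /below dT eqxx andbT.
by case: (x \in _); case: (T <= x)%VS; rewrite /= ?mul0rn ?mulr1n ?scale1r ?scale0r.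
Qed.

Lemma charvec_orbit g : g \in unitmx -> charvec K (gl_act g @: D) \in S.
Proof. by move=> ug; apply/memv_span/image_f. Qed.

(** This places the image of N in the span of the orbit. *)
Lemma kop_coinc_num f : kop (coinc_num D) f =
  \sum_(g in unitmx) (\sum_(x in gl_act g @: D) f x) *: charvec K (gl_act g @: D).
Proof.
apply/ffunP => y; rewrite sum_ffunE ffunE.
transitivity (\sum_x \sum_(g in unitmx | (x \in gl_act g @: D) && (y \in gl_act g @: D)) f x).
  apply: eq_bigr => x _; rewrite /coinc_num -sum1_card -sumrMnr.
  by apply: eq_big => [g|g _]; rewrite ?inE ?mulr1n.
rewrite (exchange_big_dep (mem unitmx)) //= => [|x g _ /andP[]//].
apply: eq_bigr => g ug; rewrite !ffunE; case: (boolP (y \in _)) => yD.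
  by rewrite [RHS]mulr1; apply: eq_bigl => x; rewrite andbT [g \in _]ug.
by rewrite scaler0 big1 // => x; rewrite !andbF.
Qed.

Lemma coinc_num_id x y : \dim x = k -> \dim y = k -> coinc_num D x x = coinc_num D y y.
Proof. by move=> dx dy; apply: coinc_num_dim; rewrite ?capvv dx. Qed.

Lemma orbit_sum x : x \in D ->
  \sum_(g in unitmx) charvec K (gl_act g @: D) = (coinc_num D x x)%:R *: rank_one k.
Proof.
have [_ dimD _] := desD => /dimD dx; apply/ffunP => y; rewrite sum_ffunE !ffunE.
have [dy|dy] := eqVneq (\dim y) k; last first.
  by rewrite scaler0 big1 // => g ug; rewrite (level_eq0 (charvec_level ug) dy).
rewrite [RHS]mulr1 (coinc_num_id dx dy) /coinc_num -sum1_card natr_sum.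
rewrite big_mkcond [RHS]big_mkcond; apply: eq_bigr => g _.
by rewrite inE ffunE andbb; case: (g \in unitmx); case: (y \in _).
Qed.

Lemma rank_one_orbit : rank_one k \in S.
Proof.
have [D0 dimD _] := desD; have /set0Pn[x xD] := D0.
have N0 : (coinc_num D x x)%:R != 0 :> K by rewrite pnatr_eq0 -lt0n coinc_num_id_gt0.
rewrite -[rank_one k](scalerK N0) -orbit_sum // memvZ // memv_suml // => g ug.
exact: charvec_orbit.
Qed.

(** The sum of the values is the incidence map of rank 0. *)
Lemma sum_kernel f : f \in E0 -> \sum_x f x = 0 :> K.
Proof.
case/design_kernelP => fk f0.
have := @inc_eq0_le _ _ _ k 0 t f fk (ltnW tk) f0.
by move/ffunP/(_ 0%VS); rewrite inc0E ffunE.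
Qed.

Lemma coinc_num_kernel f : f \in E0 -> kop (coinc_num D) f \in E0.
Proof.
move=> fE; apply/design_kernelP; rewrite kop_coinc_num; split.
  by apply: memv_suml => g ug; rewrite memvZ // charvec_level.
rewrite linear_sum /=.
under eq_bigr => g ug do rewrite linearZ /= inc_charvec //.
rewrite -scaler_suml.
have -> : \sum_(g in unitmx) \sum_(x in gl_act g @: D) f x = 0 :> K.
  have [D0 dimD _] := desD; have /set0Pn[x0 x0D] := D0.
  transitivity (\sum_x f x *+ coinc_num D x0 x0 : K); last first.
    by rewrite sumrMnl sum_kernel // mul0rn.
  rewrite (exchange_big_dep predT) //=; apply: eq_bigr => x _.
  have [dx|dx] := eqVneq (\dim x) k; last first.
    have /design_kernelP[fk _] := fE.
    by rewrite (level_eq0 fk dx) mul0rn big1.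
  rewrite (coinc_num_id (dimD _ x0D) dx) -sumr_const; apply: eq_bigl => g.
  by rewrite inE andbb.
by rewrite scale0r.
Qed.

(** N is an injective endomorphism of E0 with image in the span of the orbit, so
    E0 is that image. *)
Lemma kernel_orbit : (E0 <= S)%VS.
Proof.
pose N := linfun (kop (coinc_num D)) : 'End(V).
have Ninj : (E0 :&: lker N = 0)%VS.
  apply/eqP; rewrite -subv0; apply/subvP => f /memv_capP[/design_kernelP[fk f0]].
  rewrite memv_ker lfunE memv0 => /eqP Nf.
  by apply/eqP; apply: (coinc_num_definite tk desD n_large cjP fk f0 Nf).
have NE : (N @: E0 <= E0)%VS.
  by apply/subvP => f /memv_imgP[h hE ->]; rewrite lfunE /= coinc_num_kernel.
have -> : E0 = (N @: E0)%VS.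
  by apply/eqP; rewrite eq_sym eqEdim NE (limg_dim_eq Ninj) /=.
apply/subvP => f /memv_imgP[h hE ->]; rewrite lfunE /= kop_coinc_num.
by apply: memv_suml => g ug; rewrite memvZ // charvec_orbit.
Qed.

(** A translate of the characteristic vector differs from the average of its
    orbit, a multiple of 1, by an element of E0. *)
Lemma orbit_spanE : S = (<[rank_one k]> + E0)%VS.
Proof.
apply/eqP; rewrite eqEsubv subv_add -memvE rank_one_orbit kernel_orbit !andbT.
have [D0 dimD _] := desD; have /set0Pn[x xD] := D0.
set N0 : K := (coinc_num D x x)%:R.
have N0n0 : N0 != 0 by rewrite pnatr_eq0 -lt0n coinc_num_id_gt0.
pose G : K := #|(unitmx : {pred 'M[F]_n})|%:R.
have incN : N0 *: inc t (rank_one k) = (G * lambda%:R) *: rank_one t.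
  rewrite -linearZ /= -orbit_sum // linear_sum /=.
  under eq_bigr => g ug do rewrite inc_charvec //.
  by rewrite sumr_const -scaler_nat scalerA.
have Gn0 : G != 0.
  rewrite pnatr_eq0 -lt0n; apply/card_gt0P; exists 1%:M.
  exact: unitmx1.
apply/span_subvP => f /imageP[g ug ->{f}].
set f := charvec K _; pose a := N0 / G.
(* a *: rank_one k is the average of the orbit. *)
rewrite -[f](subrK (a *: rank_one k)) addrC.
apply: memv_add; first by rewrite memvZ // memv_line.
apply/design_kernelP; split.
  by apply: memvB; [exact: charvec_level | rewrite memvZ // rank_one_level].
rewrite linearB linearZ /= inc_charvec // /a mulrC -scalerA incN scalerA mulrA mulVf //.
by rewrite mul1r subrr.
Qed.

Lemma dim_kernel : (\dim E0 + gbin q n t = gbin q n k)%N.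
Proof.
have := limg_ker_dim (linfun (inc t)) (level K F n k).
rewrite (@inc_onto K F n cj cjP t k (ltnW tk) two_k_le_n) !dim_level => dimE.
have cardE r : #|[set x : P | \dim x == r]| = gbin q n r.
  rewrite -[in RHS](dim_full F n) -card_subspaces.
  by apply: eq_card => x; rewrite !inE subvf.
by rewrite -!cardE -dimE.
Qed.

Lemma rank_one_kernel (a : K) : a *: rank_one k \in E0 -> a = 0.
Proof.
have [D0 dimD _] := desD; have /set0Pn[x xD] := D0.
move/sum_kernel => s0; apply/eqP; rewrite -[a == 0]orbF.
have <- : (#|[set x : P | \dim x == k]|%:R == 0 :> K) = false.
  by apply/negbTE; rewrite pnatr_eq0 -lt0n; apply/card_gt0P; exists x; rewrite inE dimD.
rewrite -mulf_eq0 -[X in _ == X]s0 -sum1_card natr_sum mulr_sumr big_mkcond.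
apply/eqP/eq_bigr => y _; rewrite !ffunE inE.
by case: (_ == k); rewrite /= ?scaler0.
Qed.

Lemma dim_orbit_span :
  (\dim S)%:R = gauss_binom q n k - gauss_binom q n t + 1 :> rat.
Proof.
have kn2 := two_k_le_n.
rewrite -!gbin_gauss_binom; [|lia..].
rewrite -dim_kernel natrD addrK natr1; congr (_%:R).
rewrite orbit_spanE dimv_disjoint_sum.
  rewrite dim_vline -[RHS]add1n; congr (_ + _)%N; apply/eqP; rewrite eqb1.
  apply/negP => /eqP k0; have := @rank_one_kernel 1.
  by rewrite k0 scaler0 mem0v => /(_ isT)/eqP; rewrite oner_eq0.
apply/eqP; rewrite -subv0; apply/subvP => f /memv_capP[/vlineP[a ->]].
by move/rank_one_kernel => ->; rewrite scale0r mem0v.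
Qed.

End Span.

(** * Jordan bases *)

Lemma flatten_uniq_eq (T : eqType) (B : seq (seq T)) c c' v :
  uniq (flatten B) -> c \in B -> c' \in B -> v \in c -> v \in c' -> c = c'.
Proof.
elim: B => //= c0 B IHB; rewrite cat_uniq => /and3P[_ /hasPn disj uB].
have out d : d \in B -> v \in d -> v \notin c0.
  by move=> dB vd; apply: disj; apply/flattenP; exists d.
rewrite !inE => /predU1P[->|cB] /predU1P[->|cB'] // vc vc'.
- by have := out _ cB' vc'; rewrite vc.
- by have := out _ cB vc; rewrite vc'.
- exact: IHB.
Qed.

Section Jordan.
Variables (C : numClosedFieldType) (F : finFieldType) (n : nat).
Local Notation P := (subspace F n).
Local Notation V := (VP C F n).
Local Notation cj := (@Num.conj C).
Local Notation dot := (dot cj).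
Implicit Types (f g u v w : V) (c : seq V) (B : seq (seq V)).

Lemma conj_normP (a : C) : a * cj a = `|a| ^+ 2.
Proof. by rewrite normCK. Qed.

Lemma upE v : up v = kup v.
Proof.
apply/ffunP => y; rewrite !ffunE big_mkcond; apply: eq_bigr => x _.
by rewrite /cov; case: (_ && _).
Qed.

Lemma homogeneousE r v : homogeneous r v = (v \in level C F n r).
Proof.
apply/forallP/levelP => [vr x|vr x].
  by have := vr x; case: (\dim x == r) => //; rewrite implybF negbK => /eqP.
by have := vr x; case: (\dim x == r); rewrite ?implybT // implybF negbK => ->.
Qed.

Lemma level_inj r s v : v != 0 -> v \in level C F n r -> v \in level C F n s -> r = s.
Proof.
move=> v0 vr vs; apply/eqP; apply: contraNT v0 => rs; apply/eqP/ffunP => x.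
rewrite ffunE; have [dx|dx] := eqVneq (\dim x) r; last exact: (level_eq0 vr dx).
by apply: (level_eq0 vs); rewrite dx.
Qed.

Lemma dotC u v : dot u v = (dot v u)^*.
Proof.
rewrite rmorph_sum; apply: eq_bigr => x _.
by rewrite rmorphM /= conjCK mulrC.
Qed.

Lemma dot_suml (I : Type) (r : seq I) (p : pred I) (f : I -> V) v :
  dot (\sum_(i <- r | p i) f i) v = \sum_(i <- r | p i) dot (f i) v.
Proof.
by elim/big_rec2: _ => [|i u w _ <-]; rewrite ?dot0l ?dotDl.
Qed.

Lemma span_orthl (X : seq V) u v :
  {in X, forall w, dot w v = 0} -> u \in <<X>>%VS -> dot u v = 0.
Proof.
move=> Xv uX; rewrite (coord_span (X := in_tuple _) uX) dot_suml big1 // => i _.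
by rewrite dotZl Xv ?mulr0 // mem_nth.
Qed.

Lemma span_orth (X Y : seq V) u v :
  {in X & Y, forall w w', dot w w' = 0} -> u \in <<X>>%VS -> v \in <<Y>>%VS ->
  dot u v = 0.
Proof.
move=> XY uX vY; apply: span_orthl uX => w wX.
rewrite dotC (@span_orthl Y) ?rmorph0 // => w' wY.
by rewrite dotC XY ?rmorph0.
Qed.

Variable B : seq (seq V).
Hypothesis hB : orthogonal_symmetric_jordan_basis B.

Lemma flatten_free : free (flatten B).
Proof. by have [_ /basis_free] := hB. Qed.

Lemma flatten_orth u v : u \in flatten B -> v \in flatten B -> u != v -> dot u v = 0.
Proof. by have [_ _ orth] := hB; apply: orth. Qed.

Lemma chain_head c : c \in B ->
  head 0 c != 0 /\ exists r, head 0 c \in level C F n r.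
Proof.
have [chB _ _] := hB => /chB[c0 hom _ _ _].
have /hom[h0 [r hr]] : head 0 c \in c by case: (c) c0 => //= v c' _; rewrite mem_head.
by split=> //; exists r; rewrite -homogeneousE.
Qed.

Lemma chain_nth c m : c \in B -> (m < size c)%N -> nth 0 c m = kupn m (head 0 c).
Proof.
have [chB _ _] := hB => /chB[c0 _ srt _ _].
elim: m => [|m IHm] mc; first by rewrite nth0.
rewrite /kupn /= -/(kupn m _) -IHm ?(ltnW mc) // -upE.
by have /(sortedP 0)/(_ m mc)/eqP := srt.
Qed.

Lemma chain_kupn c m : c \in B -> kupn m (head 0 c) \in c \/ kupn m (head 0 c) = 0.
Proof.
move=> cB; have [chB _ _] := hB; have [c0 _ _ lst _] := chB c cB.
have c_gt0 : (0 < size c)%N by rewrite lt0n size_eq0.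
have [mc|cm] := ltnP m (size c); first by left; rewrite -chain_nth // mem_nth.
right; rewrite -(subnKC cm) addnC; elim: (m - size c)%N => [|j IHj]; last first.
  by rewrite addSn /kupn /= -/(kupn _ _) IHj linear0.
rewrite add0n -(prednK c_gt0) /kupn /= -/(kupn _ _) -chain_nth ?prednK //.
by rewrite -upE nth_last.
Qed.

(** Chains consist of the iterates of their head, and each step raises the rank by
    one. *)
Lemma chain_rank c v j k : c \in B -> v \in c -> head 0 c \in level C F n j ->
  v \in level C F n k -> exists2 m, k = (j + m)%N & v = kupn m (head 0 c).
Proof.
move=> cB vc hj vk; have [chB _ _] := hB; have [_ hom _ _ _] := chB c cB.
have [v0 _] := hom v vc; move: vc => /(nthP 0)[m mc vE].
have vm : v = kupn m (head 0 c) by rewrite -vE chain_nth.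
exists m => //; apply: (level_inj v0 vk); rewrite vm.
exact: kupn_level.
Qed.

(** Project an expansion in the homogeneous basis onto rank k. *)
Lemma level_span k f : f \in level C F n k ->
  f \in <<[seq v <- flatten B | homogeneous k v]>>%VS.
Proof.
move=> fk; (* projection onto rank k *)
pose pr := kop (fun x y : P => (x == y) && (\dim y == k) : nat) : V -> V.
have prE g y : pr g y = if \dim y == k then g y else 0.
  rewrite ffunE (bigD1 y) //= big1 => [|x /negPf xy]; last by rewrite xy.
  by rewrite eqxx addr0; case: (_ == k).
have prf : linfun pr f = f.
  rewrite lfunE; apply/ffunP => y; rewrite prE; case: eqP => // /eqP dy.
  by rewrite (level_eq0 fk).
have : f \in (linfun pr @: <<flatten B>>)%VS.
  have [_ /span_basis -> _] := hB.
  by rewrite -prf memv_img // memvf.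
rewrite limg_span; apply/subvP/span_subvP => _ /mapP[v vB ->].
have /flattenP[c cB vc] := vB.
have [r vr] : exists r, v \in level C F n r.
  have [chB _ _] := hB; have [_ /(_ v vc)[_ [r vr]] _ _ _] := chB c cB.
  by exists r; rewrite -homogeneousE.
have -> : linfun pr v = pr v by rewrite lfunE.
have [rk|rk] := eqVneq r k.
  have -> : pr v = v.
    by apply/ffunP => y; rewrite prE; case: eqP => // /eqP dy; rewrite (level_eq0 vr) // rk.
  by rewrite memv_span // mem_filter homogeneousE -rk vr.
have -> : pr v = 0; last exact: mem0v.
apply/ffunP => y; rewrite prE ffunE; case: eqP => // dy.
by rewrite (level_eq0 vr) // dy eq_sym.
Qed.

Lemma mem_U_generators k j v :
  reflect (exists c, [/\ c \in B, v \in c, head 0 c \in level C F n j & v \in level C F n k])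
    (v \in [seq v <- flatten [seq c <- B | homogeneous j (head 0 c)] | homogeneous k v]).
Proof.
rewrite mem_filter homogeneousE; apply: (iffP andP) => [[vk /flattenP[c]]|[c [cB vc hj vk]]].
  by rewrite mem_filter homogeneousE => /andP[hj cB] vc; exists c.
by split=> //; apply/flattenP; exists c; rewrite // mem_filter homogeneousE hj.
Qed.

(** In an orthogonal basis, the coefficient at a basis vector orthogonal to f is
    zero. *)
Lemma level_span_sub k (p : pred V) f : f \in level C F n k ->
  {in flatten B, forall v, v \in level C F n k -> ~~ p v -> dot f v = 0} ->
  f \in <<[seq v <- flatten B | homogeneous k v & p v]>>%VS.
Proof.
move=> /level_span; set X := [seq _ <- _ | _] => fX f0.
have fX' := coord_span (X := in_tuple X) fX.
have uX : uniq X by rewrite filter_uniq // free_uniq // flatten_free.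
rewrite fX'; apply: memv_suml => i _ /=.
have XiX : X`_i \in X by apply: mem_nth.
move: (XiX); rewrite mem_filter homogeneousE => /andP[Xik XiB].
have [pX|pX] := boolP (p X`_i).
  by apply/memvZ/memv_span; rewrite mem_filter homogeneousE Xik pX.
have : dot f X`_i = coord (in_tuple X) i f * dot X`_i X`_i.
  rewrite {1}fX' dot_suml (bigD1 i) //= big1 ?addr0 ?dotZl // => j ji.
  rewrite dotZl flatten_orth ?mulr0 //.
    by have := mem_nth 0 (ltn_ord j); rewrite mem_filter => /andP[].
  by rewrite (nth_uniq 0) ?ltn_ord //= ji.
rewrite f0 // => /esym/eqP; rewrite mulf_eq0 => /orP[/eqP->|/eqP/(dot_eq0 conj_normP) Xi0].
  by rewrite scale0r mem0v.
have := free_not0 flatten_free XiB; by rewrite Xi0 eqxx.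
Qed.

(** The image of [kupn (k - s)] on rank s is spanned by zero or basis vectors of
    chains that start in rank at most s. None of these is v, because distinct
    chains have no vector in common. *)
Lemma kupn_chain_orth c v j k s g : c \in B -> v \in c ->
  head 0 c \in level C F n j -> v \in level C F n k -> (s < j)%N ->
  g \in level C F n s -> dot (kupn (k - s) g) v = 0.
Proof.
move=> cB vc hj vk sj gs.
have vB : v \in flatten B by apply/flattenP; exists c.
have := memv_img (linfun (kupn (k - s))) (level_span gs).
rewrite lfunE limg_span; apply: span_orthl => _ /mapP[w + ->].
rewrite mem_filter homogeneousE lfunE /= => /andP[ws /flattenP[c' cB' wc']].
have [h0' [r hr]] := chain_head cB'.
have [m sE wE] := chain_rank cB' wc' hr ws.
have -> : kupn (k - s) w = kupn (k - s + m) (head 0 c').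
  by rewrite wE /kupn iterD.
case: (chain_kupn (k - s + m) cB') => [inc'|->]; last by rewrite dot0l.
apply: flatten_orth => //; first by apply/flattenP; exists c'.
apply/eqP => eqv; rewrite eqv in inc'.
have cc' := flatten_uniq_eq (free_uniq flatten_free) cB cB' vc inc'.
have [h0 _] := chain_head cB; rewrite -cc' in hr.
have rj := level_inj h0 hj hr.
by move: sj; rewrite sE rj ltnNge leq_addr.
Qed.

(** [inc_tr s] has the same image in rank k as [kupn (k - s)], to which v is
    orthogonal. *)
Lemma inc_chain_eq0 c v j k s : c \in B -> v \in c ->
  head 0 c \in level C F n j -> v \in level C F n k -> (s < j)%N -> (s <= k)%N ->
  inc s v = 0.
Proof.
move=> cB vc hj vk sj sk; have [a [b [a0 b0 ab]]] := @kupn_inc_tr C F n s (k - s).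
have gs : inc s v \in level C F n s by exact: inc_level.
apply: (dot_eq0 conj_normP); apply/eqP.
rewrite dotC fmorph_eq0 -(mulrn_neq0 _ b0) -{1}[inc s v]/(kop _ v).
have := dot_kop cj (below s) (inc s v) v => /esym; rewrite -/(inc s) => ->.
rewrite -dotMnl.
have -> : dot (inc_tr s (inc s v) *+ b) v = dot (kupn (k - s) (inc s v) *+ a) v.
  apply: eq_bigr => y _; rewrite !ffunMnE.
  have [dy|dy] := eqVneq (\dim y) k; last by rewrite (level_eq0 vk dy) rmorph0 !mulr0.
  by rewrite ab // subnKC.
by rewrite dotMnl (kupn_chain_orth cB vc hj vk sj gs) mul0rn.
Qed.

(** Here v lies in the image of [kupn (k - s)], hence of [inc_tr s]. *)
Lemma chain_inc_orth c v j k s f : c \in B -> v \in c ->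
  head 0 c \in level C F n j -> v \in level C F n k -> (j <= s)%N -> (s <= k)%N ->
  f \in level C F n k -> inc s f = 0 -> dot f v = 0.
Proof.
move=> cB vc hj vk js sk fk f0; have [a [b [a0 b0 ab]]] := @kupn_inc_tr C F n s (k - s).
have [m kE vE] := chain_rank cB vc hj vk.
pose g := kupn (s - j) (head 0 c).
have gs : g \in level C F n s.
  by have := kupn_level (s - j) hj; rewrite subnKC.
have vg : v = kupn (k - s) g.
  by rewrite vE /g /kupn -iterD; congr (iter _ _ _); lia.
apply/eqP; rewrite -(mulrn_neq0 _ a0) -dotMnr.
have -> : dot f (v *+ a) = dot f (inc_tr s g *+ b).
  apply: eq_bigr => y _; rewrite !ffunMnE.
  have [dy|dy] := eqVneq (\dim y) k; last by rewrite (level_eq0 fk dy) !mul0r.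
  by rewrite vg ab // subnKC.
rewrite dotMnr.
have := dot_kop cj (fun y T => below s T y) f g; rewrite -/(inc s f) f0 dot0l => <-.
by rewrite mul0rn.
Qed.

(** The summands are pairwise orthogonal. *)
Lemma U_direct k (p : pred 'I_k.+1) : directv (\sum_(j < k.+1 | p j) U_ k B j).
Proof.
apply/directv_sum_independent => us usU us0 i pi.
apply: (dot_eq0 conj_normP).
have <- : dot (\sum_(j < k.+1 | p j) us j) (us i) = dot (us i) (us i).
  rewrite dot_suml (bigD1 i) //= big1 ?addr0 // => j /andP[pj ji].
  apply: span_orth (usU j pj) (usU i pi) => v w /mem_U_generators[c [cB vc hj vk]].
  case/mem_U_generators => c' [cB' wc' hi wk].
  apply: flatten_orth; [by apply/flattenP; exists c | by apply/flattenP; exists c' |].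
  apply/eqP => vw; rewrite -vw in wc'.
  have cc' := flatten_uniq_eq (free_uniq flatten_free) cB cB' vc wc'.
  rewrite -cc' in hi; have [h0 _] := chain_head cB.
  by case/eqP: ji; apply/val_inj; apply: level_inj h0 hj hi.
by rewrite us0 dot0l.
Qed.

Lemma head_rank_le c v k r : c \in B -> v \in c -> head 0 c \in level C F n r ->
  v \in level C F n k -> (r <= k)%N.
Proof. by move=> cB vc hr /(chain_rank cB vc hr)[m -> _]; apply: leq_addr. Qed.

(** A basis vector of rank k lies in E0 or is orthogonal to it, according to the
    rank of the head of its chain. *)
Lemma U_sum t k : (t < k)%N ->
  (\sum_(j < k.+1 | (j == 0%N :> nat) || (t < j)%N) U_ k B j)%VS
    = (<[rank_one C F n k]> + design_kernel C F n t k)%VS.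
Proof.
move=> tk; apply/eqP; rewrite eqEsubv; apply/andP; split.
  apply/subv_sumP => j /orP[/eqP j0|tj]; apply/span_subvP => v /mem_U_generators[c [cB vc hj vk]].
    apply: (subvP (addvSl _ _)).
    have [a [b [a0 b0 ab]]] := @kupn_inc_tr C F n 0 k.
    rewrite j0 in hj; have [m] := chain_rank cB vc hj vk; rewrite add0n => <- vE.
    apply/vlineP; exists ((head 0 c 0%VS : C) * b%:R / a%:R).
    apply/ffunP => y; rewrite !ffunE.
    have [dy|dy] := eqVneq (\dim y) k; last by rewrite (level_eq0 vk dy) scaler0.
    have := ab _ y hj dy; rewrite -vE => vy.
    rewrite [RHS]mulr1; apply: (mulIf (_ : a%:R != 0)); first by rewrite pnatr_eq0 -lt0n.
    rewrite divfK ?pnatr_eq0 -?lt0n // !mulr_natr [LHS]vy; congr (_ *+ _).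
    rewrite ffunE (bigD1 0%VS) //= big1 ?addr0 => [|x x0].
      by rewrite /below sub0v dimv0 eqxx.
    by rewrite /below dimv_eq0 (negPf x0) andbF.
  apply: (subvP (addvSr _ _)); apply/design_kernelP; split=> //.
  exact: (inc_chain_eq0 cB vc hj vk tj (ltnW tk)).
rewrite subv_add -memvE; apply/andP; split.
  have h1 : rank_one C F n k \in U_ k B 0.
    have sub : (<<[seq v <- flatten B | homogeneous k v & v \in U_ k B 0]>> <= U_ k B 0)%VS.
      by apply/span_subvP => v; rewrite mem_filter => /andP[/andP[]].
    apply: (subvP sub); apply: (level_span_sub (rank_one_level C F n k)).
    move=> v /flattenP[c cB vc] vk vU.
    have [_ [r hr]] := chain_head cB.
    have r0 : (0 < r)%N.
      rewrite lt0n; apply: contra vU => /eqP r0; rewrite r0 in hr.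
      by apply/memv_span/mem_U_generators; exists c.
    have := inc_chain_eq0 cB vc hr vk r0 (leq0n k); move/ffunP/(_ 0%VS).
    rewrite inc0E ffunE => v0; rewrite -(rmorph0 cj) -v0 rmorph_sum.
    apply: eq_bigr => x _; rewrite ffunE.
    have [dx|dx] := eqVneq (\dim x) k; first by rewrite mul1r.
    by rewrite mul0r (level_eq0 vk dx) rmorph0.
  by apply: subvP h1; apply: (sumv_sup ord0).
apply/subvP => f /design_kernelP[fk f0].
pose p v := [exists j : 'I_k.+1, (t < j)%N && (v \in U_ k B j)].
have f_span : f \in <<[seq v <- flatten B | homogeneous k v & p v]>>%VS.
  apply: level_span_sub => // v /flattenP[c cB vc] vk.
  have [_ [r hr]] := chain_head cB; have rk := head_rank_le cB vc hr vk.
  move/existsPn/(_ (inord r)); rewrite inordK // negb_and.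
  have -> /= : v \in U_ k B r by apply/memv_span/mem_U_generators; exists c.
  rewrite orbF -leqNgt => rt.
  exact: (chain_inc_orth cB vc hr vk rt (ltnW tk) fk f0).
apply: subvP f_span; apply/span_subvP => v; rewrite mem_filter.
case/andP => /andP[_ /existsP[j /andP[tj vj]]] _.
by apply: subvP vj; apply: (sumv_sup j) => //; rewrite tj orbT.
Qed.

End Jordan.

(** * Rational and complex coefficients *)

Unset Implicit Arguments.

Theorem theorem5p12 (q k t lambda : nat)
    (q_prime_power : exists p m : nat, [/\ prime p, (0 < m)%N & q = (p ^ m)%N])
    (k_ge1 : (1 <= k)%N) (t_lt_k : (t < k)%N) (lambda_ge1 : (1 <= lambda)%N) :
  exists n0 : nat,
    forall (F : finFieldType) (n : nat) (D : {set subspace F n}),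
      #|F| = q -> (n0 <= n)%N -> (2 * k <= n)%N ->
      subspace_design t k lambda D ->
      (forall (R : realType) (B : seq (seq (VP R[i] F n))),
          orthogonal_symmetric_jordan_basis B ->
          directv (\sum_(j < k.+1 | (j == 0%N :> nat) || (t < j)%N) U_ k B j) /\
          orbit_span R[i] D
            = (\sum_(j < k.+1 | (j == 0%N :> nat) || (t < j)%N) U_ k B j)%VS) /\
      (\dim (orbit_span rat D))%:R
        = gauss_binom q n k - gauss_binom q n t + 1 :> rat.
Proof.
exists (threshold q k lambda) => F n D qE n_large _ desD.
rewrite -qE in n_large *; split=> [R B hB|].
  split; first exact: U_direct.
  rewrite (U_sum hB t_lt_k).
  exact: (orbit_spanE (@conj_normP R[i]) t_lt_k desD n_large).
have sqr_norm (a : rat) : a * idfun a = `|a| ^+ 2 by rewrite real_normK ?num_real.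
exact: (dim_orbit_span sqr_norm t_lt_k desD n_large).
Qed.
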